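(* Let $p$ and $q$ be primes such that $p\equiv 1\pmod 8$, $q\equiv 7\pmod 8$ and $p=c^2+d^2=x^2+2qy^2$ with $c,d,x,y\in\mathbb Z$, $c\equiv 1\pmod 4$, $d=2^rd_0$ and $d_0\equiv 1\pmod 4$. Assume $(c,x+d)=1$ or $(d_0,x+c)=1$. Then, for $m\in\mathbb Z$, $$(-q)^{\frac{p-1}8}\equiv\left(\frac dc\right)^m\pmod p\iff\left(\frac{c-di}{c+di}\right)^{\frac{q+1}8}\equiv i^m\pmod q.$$
   Context: $i=\sqrt{-1}$; $(m,n)$ is the greatest common divisor; $r$ is a nonnegative integer. Here $\frac dc$ and $\frac{c-di}{c+di}$ are ordinary fractions (not residue symbols). Fractions modulo $p$ are interpreted via inverses modulo $p$; the congruence modulo $q$ is in $\mathbb Z[i]/q\mathbb Z[i]$, where $c+di$ is invertible. *)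

(* Defs.v *)
(* Mathematical Components. *)
From HB Require Import structures.
From mathcomp Require Import all_boot all_order all_algebra.
From mathcomp Require Import generic_quotient ring_quotient ring.

Set Implicit Arguments.
Unset Strict Implicit.
Unset Printing Implicit Defensive.

Import Order.TTheory GRing.Theory Num.Theory.

Local Open Scope quotient_scope.
Local Open Scope ring_scope.

(* The ring Z[i]; [Gauss a b] stands for a + bi. *)
Record gaussInt : predArgType := Gauss { gre : int; gim : int }.

Definition gauss_pair (z : gaussInt) : int * int := (gre z, gim z).
Definition pair_gauss (u : int * int) : gaussInt := Gauss u.1 u.2.

Lemma gauss_pairK : cancel gauss_pair pair_gauss.
Proof. by case. Qed.

HB.instance Definition _ := Countable.copy gaussInt (can_type gauss_pairK).

Definition gadd (z w : gaussInt) := Gauss (gre z + gre w) (gim z + gim w).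
Definition gopp (z : gaussInt) := Gauss (- gre z) (- gim z).
Definition gmul (z w : gaussInt) :=
  Gauss (gre z * gre w - gim z * gim w) (gre z * gim w + gim z * gre w).

Lemma gaddA : associative gadd.
Proof. by move=> [a b] [c d] [e f]; rewrite /gadd /= !addrA. Qed.

Lemma gaddC : commutative gadd.
Proof. by move=> [a b] [c d]; congr Gauss; rewrite addrC. Qed.

Lemma gadd0 : left_id (Gauss 0 0) gadd.
Proof. by move=> [a b]; congr Gauss; rewrite add0r. Qed.

Lemma gaddN : left_inverse (Gauss 0 0) gopp gadd.
Proof. by move=> [a b]; congr Gauss; rewrite addNr. Qed.

HB.instance Definition _ :=
  GRing.isZmodule.Build gaussInt gaddA gaddC gadd0 gaddN.

Lemma gmulA : associative gmul.
Proof. by move=> [a b] [c d] [e f]; congr Gauss; rewrite /=; ring. Qed.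

Lemma gmulC : commutative gmul.
Proof. by move=> [a b] [c d]; congr Gauss; rewrite /=; ring. Qed.

Lemma gmul1 : left_id (Gauss 1 0) gmul.
Proof. by move=> [a b]; congr Gauss; rewrite /=; ring. Qed.

Lemma gmulDl : left_distributive gmul +%R.
Proof. by move=> [a b] [c d] [e f]; congr Gauss; rewrite /=; ring. Qed.

Lemma gone_neq0 : Gauss 1 0 != 0.
Proof. by []. Qed.

HB.instance Definition _ := GRing.Zmodule_isComNzRing.Build gaussInt
  gmulA gmulC gmul1 gmulDl gone_neq0.

Definition gaussI : gaussInt := Gauss 0 1.

Lemma gaussI_sqr : gaussI ^+ 2 = -1.
Proof. by []. Qed.

Lemma gauss_natr (n : nat) : n%:R = Gauss n 0.
Proof. by elim: n => // n IHn; rewrite -addn1 natrD IHn; congr Gauss. Qed.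

Lemma gauss_intr (a : int) : a%:~R = Gauss a 0.
Proof. by case: a => n; rewrite ?NegzE ?mulrNz -!pmulrn gauss_natr. Qed.

Lemma gaussE (z : gaussInt) : z = (gre z)%:~R + (gim z)%:~R * gaussI.
Proof.
by rewrite !gauss_intr; case: z => a b; congr Gauss; rewrite /=; ring.
Qed.

Section GaussMod.

Variable n : nat.

(* As for ['Z_n], the modulus is n when n > 1, and 2 otherwise, so that the
   quotient is always a nontrivial ring. *)
Definition gmodulus : nat := (Zp_trunc n).+2.

Lemma gmodulusE : (1 < n)%N -> gmodulus = n.
Proof. exact: Zp_cast. Qed.

(* The ideal generated by n in Z[i], see [gidealP]. *)
Definition gideal : pred gaussInt :=
  fun z => ((gmodulus%:Z %| gre z) && (gmodulus%:Z %| gim z))%Z.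

Lemma gidealP (z : gaussInt) :
  reflect (exists w, z = gmodulus%:R * w) (z \in gideal).
Proof.
apply: (iffP andP) => [[/dvdzP[a Da] /dvdzP[b Db]] | [w ->]].
  exists (Gauss a b); rewrite gauss_natr; case: z Da Db => x y /= -> ->.
  by congr Gauss; rewrite /=; ring.
rewrite gauss_natr /= !mul0r subr0 addr0.
by rewrite !dvdz_mulr.
Qed.

Lemma gideal_closed : idealr_closed gideal.
Proof.
split=> // z u v /gidealP[u' ->] /gidealP[v' ->].
by apply/gidealP; exists (z * u' + v'); ring.
Qed.

HB.instance Definition _ := isIdealr.Build gaussInt gideal gideal_closed.

Definition gidealr : idealr gaussInt := gideal.

(* The ring Z[i]/nZ[i]. *)
Definition gaussMod : Type := {ideal_quot gidealr}.

HB.instance Definition _ := GRing.ComNzRing.on gaussMod.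

Definition gmod (z : gaussInt) : gaussMod := \pi_{ideal_quot gidealr} z.

HB.instance Definition _ :=
  GRing.RMorphism.copy gmod \pi_{ideal_quot gidealr}.

Lemma gmodP (z w : gaussInt) : (gmod z = gmod w) <-> (z - w \in gideal).
Proof.
rewrite -(Quotient.equivE gidealr); split=> [/eqmodP // | h].
by apply/eqmodP.
Qed.

Lemma gmod_repr (x : gaussMod) : gmod (repr x) = x.
Proof. exact: reprK. Qed.

(* The class of z is invertible if and only if the norm N(z) is prime to n,
   and its inverse is then the conjugate of z divided by N(z) modulo n. *)
Definition gnorm (z : gaussInt) : int := gre z ^+ 2 + gim z ^+ 2.
Definition gconj (z : gaussInt) : gaussInt := Gauss (gre z) (- gim z).

Definition gmod_unit (x : gaussMod) : bool :=
  coprimez gmodulus%:Z (gnorm (repr x)).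

Definition gmod_inv (x : gaussMod) : gaussMod :=
  if gmod_unit x then
    let z := repr x in gmod ((egcdz gmodulus%:Z (gnorm z)).2%:~R * gconj z)
  else x.

Lemma gmod_mulVr : {in gmod_unit, left_inverse 1 gmod_inv *%R}.
Proof.
move=> x Ux; rewrite /gmod_inv; have -> : gmod_unit x by [].
rewrite /= -[in X in _ * X](gmod_repr x) -rmorphM.
have [u v Duv _] := egcdzP gmodulus%:Z (gnorm (repr x)).
rewrite (eqP Ux) in Duv.
rewrite -(rmorph1 gmod); apply/gmodP/gidealP; exists (- u%:~R); rewrite gauss_natr !gauss_intr /=.
case: (repr x) Duv => a b; rewrite /gnorm /= => Duv.
have {}Duv : v * (a ^+ 2 + b ^+ 2) = 1 - u * gmodulus%:Z.
  by rewrite -Duv; ring.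
congr Gauss; rewrite /=; last by ring.
transitivity (v * (a ^+ 2 + b ^+ 2) - 1); first by ring.
by rewrite Duv; ring.
Qed.

Lemma gmod_unitPl (x y : gaussMod) : y * x = 1 -> gmod_unit x.
Proof.
rewrite -[y]gmod_repr -[in X in X -> _](gmod_repr x) -rmorphM.
rewrite -(rmorph1 gmod) => /gmodP/gidealP[w]; rewrite gauss_natr /gmod_unit.
case: (repr x) (repr y) w => a b [c d] [e f] /eqP.
rewrite -subr_eq0 => /eqP[Dre Dim].
set g := gcdz gmodulus%:Z (gnorm (Gauss a b)).
have gm : (g %| gmodulus%:Z)%Z by exact: dvdz_gcdl.
have gN : (g %| gnorm (Gauss a b))%Z by exact: dvdz_gcdr.
rewrite /coprimez -/g; suff g1 : (g %| 1%R)%Z.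
  by move: g1; rewrite dvdz1 /g /gcdz absz_nat.
have Dc : c * a - d * b = 1 + gmodulus%:Z * e.
  by apply/eqP; rewrite -subr_eq0; apply/eqP; rewrite -[RHS]Dre; ring.
have Dd : c * b + d * a = gmodulus%:Z * f.
  by apply/eqP; rewrite -subr_eq0; apply/eqP; rewrite -[RHS]Dim; ring.
have -> : 1 = gnorm (Gauss c d) * gnorm (Gauss a b)
    - gmodulus%:Z * (2 * e + gmodulus%:Z * e ^+ 2 + gmodulus%:Z * f ^+ 2).
  transitivity ((c * a - d * b) ^+ 2 + (c * b + d * a) ^+ 2
    - gmodulus%:Z * (2 * e + gmodulus%:Z * e ^+ 2 + gmodulus%:Z * f ^+ 2)).
    by rewrite Dc Dd; ring.
  by rewrite /gnorm /=; ring.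
by apply: rpredB; [exact: dvdz_mull | exact: dvdz_mulr].
Qed.

Lemma gmod_inv_out : {in [predC gmod_unit], gmod_inv =1 id}.
Proof. by move=> x /negPf Ux; rewrite /gmod_inv [gmod_unit x]Ux. Qed.

HB.instance Definition _ := GRing.ComNzRing_hasMulInverse.Build gaussMod
  gmod_mulVr gmod_unitPl gmod_inv_out.

(* The class of i in Z[i]/nZ[i]. *)
Definition gmodI : gaussMod := gmod gaussI.

Lemma gmodE (z : gaussInt) : gmod z = (gre z)%:~R + (gim z)%:~R * gmodI.
Proof. by rewrite [z in LHS]gaussE rmorphD rmorphM !rmorph_int. Qed.

Lemma gmodI_unit : gmodI \is a GRing.unit.
Proof.
by apply/unitrPr; exists (- gmodI); rewrite mulrN -rmorphM -rmorphN rmorph1.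
Qed.

End GaussMod.

(* Main.v *)
From HB Require Import structures.
Require Import Defs.
From mathcomp Require Import all_boot all_order all_algebra.
From mathcomp Require Import cyclic all_field ring zify.
Import Order.TTheory GRing.Theory Num.Theory.
Local Open Scope ring_scope.

Set Implicit Arguments.
Unset Strict Implicit.
Unset Printing Implicit Defensive.

(** Write t = d/c, a square root of -1 in F_p, and z = c + di. Let chi be a
   character of order 8 of F_p such that chi(a) corresponds to a^((p-1)/8) under an
   identification of the eighth roots of unity that matches i with t. Since -q is a
   square modulo p, chi(-q) is a power of i, and the theorem says that
   chi(-q) = (conj z / z)^((q+1)/8) in characteristic q.

   The proof evaluates a power of the Gauss sum G of chi in an algebraic closure
   of F_q in two ways. As q = -1 modulo 8, the q-th power map sends G to the Gauss
   sum of the inverse character, up to chi(q), whence G^(q+1) = chi(-q) p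
   (octic_gauss_power). On the other hand G^8 = K^4 J^2 p (gauss_octic), where
   K = u + v sqrt(-2) and J = a + bi are the Jacobi sums of chi and chi^2 with the
   quadratic character. Both have norm p, u and a are -1 modulo 4, and J vanishes
   at the place i = t of F_p, so that J = -z (jacobi_coordinates,
   two_squares_unique). Therefore
     chi(-q) p = (K^4 J^2 p)^((q+1)/8),
   which only involves K^((q+1)/2) and z^((q+1)/2) besides the quotient of conj z
   and z that the theorem is about.

   Modulo q the prime p is the square of x, and an element of F_(q^2) of norm x^2
   has (q+1)/2-th power x or -x: for z the sign is the Legendre symbol of
   2 (x + c) modulo q, because (z + x)^2 = 2 (x + c) z, and likewise for -K with -u
   in place of c (half_power). Now
     (x + c)(x - c) = d^2 - 2 q y^2  and  (x + u)(x - u) = 2 v^2 - 2 q y^2,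
   so 2q, respectively q, is a square modulo every odd prime that divides these
   factors to an odd power. By quadratic reciprocity the Legendre symbol of such a
   factor then only depends on its odd part modulo 8 (legendre_of_form,
   half_power_sign). A computation at the prime 2, which also needs
   (u + c)(u - c) = d^2 - 2 v^2 and the primes modulo which 2 is a square, shows
   that the two signs agree (kappa_compare); they cancel, and the formula for
   chi(-q) follows (octic_symbol). *)

(** * Multiplicative characters of a prime field *)

Lemma Fp_generator (p : nat) : prime p ->
  exists g : 'F_p, p.-1.-primitive_root g.
Proof.
move=> p_pr; have cardF : #|'F_p| = p by rewrite card_Fp.
pose rs := rem (0 : 'F_p) (enum 'F_p).
have sz : size rs = p.-1 by rewrite size_rem ?mem_enum // -cardE cardF.
have mem_rs x : (x \in rs) = (x != 0).
  by rewrite mem_rem_uniq ?enum_uniq // inE mem_enum inE andbT.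
have/hasP[g _ pg] : has p.-1.-primitive_root rs.
  apply: has_prim_root; rewrite ?sz ?rem_uniq ?enum_uniq //.
    by have := prime_gt1 p_pr; case: (p) => [|[]].
  apply/allP => x; rewrite mem_rs => x0; rewrite unity_rootE -subr_eq0.
  rewrite -(inj_eq (mulfI x0)) mulr0 mulrBr mulr1 subr_eq0 -exprS.
  have := expf_card x; rewrite cardF => e.
  by rewrite prednK ?prime_gt0 // e.
by exists g.
Qed.

Section Characters.

Variables (p : nat) (g : 'F_p).
Hypotheses (p_pr : prime p) (g_prim : p.-1.-primitive_root g).

Definition ind (a : 'F_p) : nat := find (fun k => g ^+ k == a) (iota 0 p.-1).

Lemma Fp_fermat (a : 'F_p) : a != 0 -> a ^+ p.-1 = 1.
Proof.
move=> a0; apply: (mulfI a0); rewrite -exprS prednK ?prime_gt0 // mulr1.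
by have := expf_card a; rewrite card_Fp.
Qed.

Lemma indK (a : 'F_p) : a != 0 -> g ^+ ind a = a.
Proof.
move=> a0; have [k ak] := prim_rootP g_prim (Fp_fermat a0).
have h : has (fun k => g ^+ k == a) (iota 0 p.-1).
  by apply/hasP; exists (k : nat); rewrite ?mem_iota ?ltn_ord // -ak.
have := nth_find 0%N h; rewrite nth_iota => [/eqP //|].
by move: h; rewrite has_find size_iota.
Qed.

Lemma gen_neq0 : g != 0.
Proof.
apply: contra_eq_neq (prim_expr_order g_prim) => ->.
by rewrite expr0n eqn0Ngt (prim_order_gt0 g_prim) eq_sym oner_neq0.
Qed.

Lemma natF_neq0 (a : nat) : (0 < a < p)%N -> a%:R != 0 :> 'F_p.
Proof.
move=> /andP[a0 ap]; rewrite -val_eqE /= val_Fp_nat // modn_small //.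
by rewrite -lt0n.
Qed.

(** The character that sends the generator g to z, provided z^(p-1) = 1. The ring
   of values is arbitrary: the same characters are needed with values in the
   integers, in F_p, in algebraic numbers and in characteristic q. *)
Definition chi (R : nzRingType) (z : R) (a : 'F_p) : R :=
  if a == 0 then 0 else z ^+ ind a.

Section Values.
Variable R : comNzRingType.
Implicit Types y z : R.

Lemma chi0 z : chi z 0 = 0. Proof. by rewrite /chi eqxx. Qed.

Lemma chi_ind z a : a != 0 -> chi z a = z ^+ ind a.
Proof. by rewrite /chi => /negPf->. Qed.

Lemma chiMl y z a : chi (y * z) a = chi y a * chi z a.
Proof. by rewrite /chi; case: eqP; rewrite ?mulr0 // exprMn. Qed.

Lemma chi_one a : chi (1 : R) a = (a != 0)%:R.
Proof. by rewrite /chi expr1n; case: eqP. Qed.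

Lemma chi_gen z k : z ^+ p.-1 = 1 -> chi z (g ^+ k) = z ^+ k.
Proof.
move=> z1; rewrite chi_ind ?expf_neq0 ?gen_neq0 //.
have /eqP : g ^+ ind (g ^+ k) = g ^+ k by rewrite indK ?expf_neq0 ?gen_neq0.
by rewrite (eq_prim_root_expr g_prim) => /eqP e; rewrite -(expr_mod _ z1) e expr_mod.
Qed.

Lemma chiM z a b : z ^+ p.-1 = 1 -> chi z (a * b) = chi z a * chi z b.
Proof.
move=> z1; have [->|a0] := eqVneq a 0; first by rewrite mul0r chi0 mul0r.
have [->|b0] := eqVneq b 0; first by rewrite mulr0 chi0 mulr0.
by rewrite -{1}(indK a0) -{1}(indK b0) -exprD chi_gen // exprD !chi_ind.
Qed.

Lemma chi1 z : z ^+ p.-1 = 1 -> chi z 1 = 1.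
Proof. by move=> z1; have := chi_gen 0 z1; rewrite !expr0. Qed.

Lemma chiX z a k : z ^+ p.-1 = 1 -> chi z (a ^+ k) = chi z a ^+ k.
Proof.
by move=> z1; elim: k => [|k IHk]; rewrite ?expr0 ?chi1 // !exprS chiM ?IHk.
Qed.

Lemma chi_morph (S : comNzRingType) (f : {rmorphism R -> S}) z a :
  f (chi z a) = chi (f z) a.
Proof. by rewrite /chi; case: eqP; rewrite ?rmorph0 ?rmorphXn. Qed.

End Values.

Lemma chi_neq0 (R : fieldType) (z : R) a :
  z ^+ p.-1 = 1 -> a != 0 -> chi z a != 0.
Proof.
move=> z1 a0; rewrite chi_ind // expf_neq0 //; apply: contra_eq_neq z1 => ->.
by rewrite expr0n eqn0Ngt (prim_order_gt0 g_prim) eq_sym oner_neq0.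
Qed.

(** Multiplying the variable by a generator multiplies the sum by z. *)
Lemma sum_chi (R : idomainType) (z : R) :
  z ^+ p.-1 = 1 -> z != 1 -> \sum_a chi z a = 0.
Proof.
move=> z1 zn1; apply/eqP; have : z * (\sum_a chi z a) == \sum_a chi z a.
  rewrite mulr_sumr [X in _ == X](reindex_inj (mulfI gen_neq0)) /=.
  by apply/eqP/eq_bigr => a _; rewrite chiM // [chi z g](chi_gen 1 z1).
by rewrite -subr_eq0 -{2}[\sum_a _]mul1r -mulrBl mulf_eq0 subr_eq0 (negPf zn1).
Qed.

(** * Gauss and Jacobi sums *)

Definition jacobi (R : comNzRingType) (y z : R) : R :=
  \sum_a chi y a * chi z (1 - a).

Lemma jacobiC (R : comNzRingType) (y z : R) : jacobi y z = jacobi z y.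
Proof.
rewrite /jacobi (reindex_inj (inv_inj (subKr 1))) /=.
by apply: eq_bigr => a _; rewrite subKr mulrC.
Qed.

Section Gauss.

Variables (L : fieldType) (w : L).
Hypotheses (wp : w ^+ p = 1) (wn1 : w != 1).

Definition addchar (a : 'F_p) : L := w ^+ a.

Lemma addchar_nat k : addchar k%:R = w ^+ k.
Proof. by rewrite /addchar val_Fp_nat // expr_mod. Qed.

Lemma addcharD a b : addchar (a + b) = addchar a * addchar b.
Proof.
by rewrite -{1}(natr_Zp a) -{1}(natr_Zp b) -natrD addchar_nat exprD.
Qed.

Lemma sum_addchar b : \sum_a addchar (a * b) = if b == 0 then p%:R else 0.
Proof.
case: eqP => [->|/eqP b0].
  under eq_bigr do rewrite mulr0 /addchar expr0.
  by rewrite sumr_const card_Fp.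
transitivity (\sum_a addchar a); first by rewrite [RHS](reindex_inj (mulIf b0)).
apply/eqP.
have : w * (\sum_a addchar a) == \sum_a addchar a.
  rewrite mulr_sumr [X in _ == X](reindex_inj (addrI 1)) /=.
  by apply/eqP/eq_bigr => a _; rewrite addcharD -[1]/(1%:R) addchar_nat expr1.
by rewrite -subr_eq0 -{2}[\sum_a _]mul1r -mulrBl mulf_eq0 subr_eq0 (negPf wn1).
Qed.

Definition gauss (z : L) : L := \sum_a chi z a * addchar a.

Lemma gauss_twist z b : z ^+ p.-1 = 1 -> b != 0 ->
  chi z b * (\sum_a chi z a * addchar (b * a)) = gauss z.
Proof.
move=> z1 b0; rewrite /gauss [RHS](reindex_inj (mulfI b0)) mulr_sumr /=.
by apply: eq_bigr => a _; rewrite chiM // mulrA.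
Qed.

(** In the double sum, the terms chi y a * chi z b with a + b = t add up to
   chi (y * z) t times the Jacobi sum when t is not 0, by scaling, and to a multiple
   of the sum of chi (y * z), which vanishes, when t = 0. *)
Lemma gauss_jacobi y z : y ^+ p.-1 = 1 -> z ^+ p.-1 = 1 -> y * z != 1 ->
  gauss y * gauss z = jacobi y z * gauss (y * z).
Proof.
move=> y1 z1 yz.
have -> : gauss y * gauss z =
    \sum_t (\sum_a chi y a * chi z (t - a)) * addchar t.
  rewrite /gauss big_distrlr /=; under [RHS]eq_bigr do rewrite mulr_suml.
  rewrite [RHS]exchange_big /=; apply: eq_bigr => a _.
  rewrite [RHS](reindex_inj (addrI a)) /=; apply: eq_bigr => b _.
  by rewrite addcharD addrC addKr mulrACA.
rewrite /gauss mulr_sumr; apply: eq_bigr => t _; rewrite mulrA; congr (_ * _).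
have [->|t0] := eqVneq t 0.
  rewrite chi0 mulr0.
  transitivity (chi z (-1) * \sum_a chi (y * z) a).
    rewrite mulr_sumr; apply: eq_bigr => a _.
    by rewrite sub0r -[- a]mulN1r chiM // chiMl mulrCA.
  by rewrite sum_chi ?mulr0 // exprMn y1 z1 mulr1.
rewrite (reindex_inj (mulfI t0)) mulr_suml /=; apply: eq_bigr => a _.
rewrite -[X in X - _]mulr1 -mulrBr !chiM // chiMl; ring.
Qed.

(** After the substitution a -> b a the characters of b cancel, so that the sum
   over b is one of values of the additive character: only a = -1 contributes p. *)
Lemma gaussM_inv y z : y ^+ p.-1 = 1 -> y * z = 1 -> y != 1 ->
  gauss y * gauss z = chi y (-1) * p%:R.
Proof.
move=> y1 yz yn1.
have z1 : z ^+ p.-1 = 1 by rewrite -[LHS]mul1r -{1}y1 -exprMn yz expr1n.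
have -> : gauss y * gauss z =
    \sum_a \sum_(b | b != 0) chi y a * addchar (b * (a + 1)).
  rewrite /gauss mulrC big_distrlr /= [RHS]exchange_big [LHS](bigD1 0) //=.
  rewrite big1 ?add0r => [|a _]; last by rewrite chi0 !mul0r.
  apply: eq_bigr => b b0; rewrite (reindex_inj (mulfI b0)); apply: eq_bigr => a _.
  rewrite chiM // mulrDr mulr1 addcharD /=.
  transitivity ((chi y b * chi z b) * (chi y a * (addchar (b * a) * addchar b))); first by ring.
  by rewrite -chiMl yz chi_one b0 mul1r.
have inner a : \sum_(b | b != 0) chi y a * addchar (b * (a + 1)) =
    chi y a * (if a == -1 then p%:R else 0) - chi y a.
  rewrite -mulr_sumr; have := sum_addchar (a + 1); rewrite addr_eq0 => <-.
  by rewrite [in RHS](bigD1 0) //= mul0r {2}/addchar expr0; ring.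
rewrite (eq_bigr _ (fun a _ => inner a)) sumrB sum_chi // subr0.
by rewrite (bigD1 (-1)) //= eqxx big1 ?addr0 // => a /negPf->; rewrite mulr0.
Qed.

(** The Frobenius map raises the values of both characters to the power l. For the
   additive one this multiplies the variable by l, which is undone by scaling. *)
Lemma gauss_frobenius (l : nat) z : l \in [pchar L] -> (l%:R : 'F_p) != 0 ->
  z ^+ p.-1 = 1 -> chi (z ^+ l) (l%:R) * gauss z ^+ l = gauss (z ^+ l).
Proof.
move=> charl l0 z1; have zl1 : (z ^+ l) ^+ p.-1 = 1 by rewrite exprAC z1 expr1n.
rewrite -(gauss_twist zl1 l0); congr (_ * _).
rewrite -(pFrobenius_autE charl) rmorph_sum; apply: eq_bigr => a _.
rewrite rmorphM chi_morph /= !pFrobenius_autE; congr (_ * _).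
by rewrite -{2}(natr_Zp a) -natrM addchar_nat mulnC exprM.
Qed.

End Gauss.

End Characters.

(** * The quadratic character *)

Lemma double_half_predp (p : nat) : odd p -> (2 * p.-1./2 = p.-1)%N.
Proof. lia. Qed.

Lemma sign_predp (R : comNzRingType) (p : nat) : odd p -> (-1) ^+ p.-1 = 1 :> R.
Proof. by move/double_half_predp <-; rewrite exprM sqrrN !expr1n. Qed.

Lemma two_neq0_Fp (p : nat) : prime p -> odd p -> 2%:R != 0 :> 'F_p.
Proof.
move=> p_pr p_odd; rewrite natF_neq0 //=.
by move: p_odd (prime_gt1 p_pr); case: (p) => [|[|[]]].
Qed.

Lemma Fp_oppr1_neq1 (p : nat) : prime p -> odd p -> -1 != 1 :> 'F_p.
Proof.
move=> p_pr p_odd; rewrite eq_sym -subr_eq0 opprK -[1 + 1]/(2%:R).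
exact: two_neq0_Fp.
Qed.

Section Quadratic.

Variables (p : nat) (g : 'F_p).
Hypotheses (p_pr : prime p) (g_prim : p.-1.-primitive_root g) (p_odd : odd p).

Lemma gen_half : g ^+ p.-1./2 = -1.
Proof.
have : (g ^+ p.-1./2) ^+ 2 == 1.
  by rewrite -exprM mulnC double_half_predp // (prim_expr_order g_prim).
rewrite sqrf_eq1 => /orP[|/eqP//]; rewrite -(prim_order_dvd g_prim) => /dvdn_leq.
by move: p_odd (prime_gt1 p_pr) => *; lia.
Qed.

Lemma euler_ind a : a != 0 -> a ^+ p.-1./2 = (-1) ^+ ind g a.
Proof. by move=> a0; rewrite -{1}(indK p_pr g_prim a0) exprAC gen_half. Qed.

Lemma euler_chi a : a ^+ p.-1./2 = chi g (-1) a.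
Proof.
have [->|a0] := eqVneq a 0; last by rewrite euler_ind // chi_ind.
by rewrite chi0 expr0n; move: p_odd (prime_gt1 p_pr); case: eqP => //; lia.
Qed.

Lemma even_ind_square a : a != 0 -> ~~ odd (ind g a) ->
  a = (g ^+ (ind g a)./2) ^+ 2.
Proof.
by move=> a0 ev; rewrite -exprM muln2 even_halfK ?(negPf ev) // indK.
Qed.

Lemma chi_sqr (R : comNzRingType) a : a != 0 -> chi g (-1 : R) (a ^+ 2) = 1.
Proof.
move=> a0; rewrite expr2 chiM ?sign_predp // -expr2 chi_ind // -exprM mulnC.
by rewrite exprM sqrrN !expr1n.
Qed.

(** A value t has [1 + chi (-1) t] square roots. *)
Lemma sum_over_squares (R : comNzRingType) (F : 'F_p -> R) :
  \sum_b F (b ^+ 2) = \sum_t (1 + chi g (-1) t) * F t.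
Proof.
rewrite (partition_big (fun b : 'F_p => b ^+ 2) xpredT) //.
apply: eq_bigr => t _; transitivity (\sum_(b : 'F_p | b ^+ 2 == t) F t).
  by apply: eq_bigr => b /eqP->.
have [-> | t0] := eqVneq t 0.
  rewrite (big_pred1 0) => [|b]; last by rewrite sqrf_eq0.
  by rewrite chi0 addr0 mul1r.
case ev: (odd (ind g t)).
  rewrite chi_ind // -signr_odd ev expr1 subrr mul0r big_pred0 // => b.
  apply/negP => /eqP tb.
  have b0 : b != 0 by move: t0; rewrite -tb sqrf_eq0.
  have := chi_sqr 'F_p b0; rewrite tb chi_ind // -signr_odd ev expr1.
  by apply/eqP; exact: Fp_oppr1_neq1.
have tE := even_ind_square t0 (negbT ev); set c := g ^+ _ in tE.
have c0 : c != 0 by move: t0; rewrite tE sqrf_eq0.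
have cN : c != - c.
  by rewrite -subr_eq0 opprK -[c + c]mulr2n -mulr_natl mulf_neq0 ?two_neq0_Fp.
have -> : chi g (-1) t = 1 :> R by rewrite tE chi_sqr.
rewrite mulrDl mul1r (bigD1 c) ?tE //=; congr (_ + _).
rewrite (big_pred1 (- c)) // => b; rewrite eqf_sqr.
by have [->|] //= := eqVneq b c; rewrite ?andbT // (negPf cN).
Qed.

(** Completing the square, 4a(1 - a) = 1 - (1 - 2a)^2. *)
Lemma jacobi_diag (R : idomainType) (z : R) :
  z ^+ p.-1 = 1 -> z != 1 -> chi g z 4%:R * jacobi g z z = jacobi g z (-1).
Proof.
move=> z1 zn1.
have n2 := two_neq0_Fp p_pr p_odd.
transitivity (\sum_b chi g z (1 - b ^+ 2)).
  rewrite /jacobi (reindex_inj (h := fun b => (1 - b) / 2%:R)); last first.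
    by apply: (can_inj (g := fun a => 1 - 2%:R * a)) => b; field.
  rewrite mulr_sumr; apply: eq_bigr => b _.
  by rewrite -!(chiM p_pr g_prim) //; congr chi; field.
rewrite (sum_over_squares (fun t => chi g z (1 - t))).
under eq_bigr do rewrite mulrDl mul1r.
rewrite big_split /= (reindex_inj (inv_inj (subKr 1))) /=.
under eq_bigr do rewrite subKr.
by rewrite (sum_chi p_pr g_prim) // add0r jacobiC.
Qed.

End Quadratic.

(** * Roots of unity in algebraically closed fields *)

(** As p is not 0, the number 1 is not a root of 1 + X + ... + X^(p-1). *)
Lemma closed_root_of_unity (L : closedFieldType) (p : nat) :
  prime p -> p%:R != 0 :> L -> exists w : L, w ^+ p = 1 /\ w != 1.
Proof.
move=> p_pr p0; have p_gt1 := prime_gt1 p_pr.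
pose P : {poly L} := \sum_(i < p) 'X^i.
have /closed_rootP[w rw] : size P != 1.
  have -> : P = \poly_(i < p) 1 by rewrite poly_def; apply: eq_bigr => i _; rewrite scale1r.
  by rewrite size_poly_eq ?oner_neq0 //; lia.
have Pw : \sum_(i < p) w ^+ i = 0.
  by move/eqP: rw; rewrite /P horner_sum; under eq_bigr do rewrite hornerXn.
exists w; split.
  by apply/eqP; rewrite -subr_eq0 subrX1 Pw mulr0.
apply: contraNneq p0 => w1; move: Pw; rewrite w1.
by under eq_bigr do rewrite expr1n; rewrite sumr_const card_ord => ->.
Qed.

Lemma closed_root8 (L : closedFieldType) : exists z : L, z ^+ 4 = -1.
Proof.
have /closed_rootP[z rz] : size ('X^4 + 1%:P : {poly L}) != 1.
  by rewrite size_addl ?size_polyXn // size_polyC; case: eqP.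
by exists z; move/eqP: rz; rewrite hornerD hornerXn hornerC => /eqP; rewrite addr_eq0 => /eqP.
Qed.

Lemma Fp_closure (l : nat) : prime l ->
  exists (L : closedFieldType) (f : {rmorphism 'F_l -> L}), l \in [pchar L].
Proof.
move=> l_pr; have [L [f _]] := countable_algebraic_closure 'F_l.
exists L, f; apply/andP; split=> //.
by rewrite -(rmorph_nat f) (pcharf0 (pchar_Fp l_pr)) rmorph0.
Qed.

(** * Quadratic reciprocity *)

Lemma frobenius_sum2 (L : fieldType) (l : nat) (a b : L) : l \in [pchar L] ->
  (a + b) ^+ l = a ^+ l + b ^+ l.
Proof. by move=> hl; rewrite -!(pFrobenius_autE hl) rmorphD. Qed.

Section QuadraticReciprocity.

Variables (q l : nat).
Hypotheses (q_pr : prime q) (l_pr : prime l).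
Hypotheses (q_odd : odd q) (l_odd : odd l) (q_neq_l : q != l).

(** Reciprocity for q = 3 mod 4: the quadratic Gauss sum G of F_q satisfies
   G^2 = -q, and taking l-th powers multiplies it by (l/q). *)
Lemma quadratic_reciprocity : (q %% 4 = 3)%N ->
  exists b : bool, (l%:R : 'F_q) ^+ q.-1./2 = (-1) ^+ b /\
                   (- q%:R : 'F_l) ^+ l.-1./2 = (-1) ^+ b.
Proof.
move=> q4; have [g g_prim] := Fp_generator q_pr.
have [L [f charl]] := Fp_closure l_pr.
have q0 : q%:R != 0 :> L.
  rewrite -(dvdn_pcharf charl) dvdn_prime2 // eq_sym //.
have [w [wq wn1]] := closed_root_of_unity q_pr q0.
have l0 : l%:R != 0 :> 'F_q.
  by rewrite -(dvdn_pcharf (pchar_Fp q_pr)) dvdn_prime2.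
have Nn1 : -1 != 1 :> L.
  rewrite eq_sym -subr_eq0 opprK -[1 + 1]/(2%:R) -(dvdn_pcharf charl).
  by rewrite dvdn_prime2 //; apply: contraTneq l_odd => ->.
pose G := gauss g w (-1 : L).
have sq1 : (-1) ^+ q.-1 = 1 :> L := sign_predp _ q_odd.
have chiN1 : chi g (-1) (-1) = -1 :> L.
  have n0 : -1 != 0 :> 'F_q by rewrite oppr_eq0 oner_neq0.
  (* The exponent in Euler's criterion for -1 is odd. *)
  have E : (-1) ^+ odd q.-1./2 = (-1) ^+ odd (ind g (-1)) :> 'F_q.
    by rewrite !signr_odd (euler_ind q_pr g_prim).
  rewrite chi_ind // -signr_odd; move: E; have -> : odd q.-1./2 by move: q4; lia.
  case: (odd (ind g _)) => //; rewrite expr1 expr0 => /eqP.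
  by rewrite (negPf (Fp_oppr1_neq1 q_pr q_odd)).
have G2 : G ^+ 2 = - q%:R.
  by rewrite expr2 (gaussM_inv q_pr g_prim) // ?mulrNN ?mulr1 // chiN1 mulN1r.
have G0 : G != 0 by rewrite -sqrf_eq0 G2 oppr_eq0.
exists (odd (ind g (l%:R))); rewrite !signr_odd; split; first exact: euler_ind.
apply: (fmorph_inj f); rewrite !rmorphXn !rmorphN rmorph1 rmorph_nat -G2 -exprM.
have Nl : (-1) ^+ l = -1 :> L by rewrite -signr_odd l_odd expr1.
have := gauss_frobenius q_pr g_prim wq charl l0 sq1; rewrite Nl -/G.
have lE : l = (2 * l.-1./2).+1.
  by rewrite double_half_predp ?prednK ?prime_gt0.
rewrite [X in G ^+ X]lE exprSr mulrA => /(canRL (mulfK G0)); rewrite divff // => e.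
have := congr1 ( *%R (chi g (-1) l%:R)) e; rewrite mulr1 mulrA -expr2 chi_ind //.
by rewrite -exprM mulnC exprM sqrrN !expr1n mul1r.
Qed.

End QuadraticReciprocity.

Lemma expr_root8_mod (R : comNzRingType) (z : R) k : z ^+ 4 = -1 ->
  z ^+ k = z ^+ (k %% 8).
Proof.
by move=> z4; rewrite expr_mod // -[8%N]/(4 * 2)%N exprM z4 sqrrN expr1n.
Qed.

Lemma root8_powers (R : comNzRingType) (z : R) : z ^+ 4 = -1 ->
  [/\ z ^+ 5 = - z, z ^+ 6 = - z ^+ 2 & z ^+ 7 = - z ^+ 3].
Proof.
by move=> z4; split; [rewrite -[5%N]/(4 + 1)%N | rewrite -[6%N]/(4 + 2)%N |
  rewrite -[7%N]/(4 + 3)%N]; rewrite exprD z4 mulN1r ?expr1.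
Qed.

Section Supplements.

Variables (l : nat).
Hypotheses (l_pr : prime l) (l_odd : odd l).

(** Euler's criterion read off a square root eta of a in an extension of F_l: the
   power a^((l-1)/2) is eta^(l-1). Both supplements below use an eta that is a sum
   of two eighth roots of unity, so that eta^l depends on l modulo 8 only. *)
Lemma euler_of_root (L : fieldType) (f : {rmorphism 'F_l -> L}) (eta : L) (a : 'F_l)
    (b : bool) :
  a != 0 -> eta ^+ 2 = f a -> eta ^+ l = (-1) ^+ b * eta ->
  a ^+ l.-1./2 = (-1) ^+ b.
Proof.
move=> a0 eta2 etal; apply: (fmorph_inj f); rewrite !rmorphXn rmorphN1 -eta2 -exprM.
rewrite double_half_predp //.
have eta0 : eta != 0 by rewrite -sqrf_eq0 eta2 fmorph_eq0.
by apply: (mulIf eta0); rewrite -exprSr prednK ?prime_gt0.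
Qed.

Lemma legendre_neg2 :
  (- 2%:R : 'F_l) ^+ l.-1./2 = (-1) ^+ ((l %% 8 == 5) || (l %% 8 == 7))%N.
Proof.
have [L [f charl]] := Fp_closure l_pr; have [z z4] := closed_root8 L.
apply: (euler_of_root (f := f) (eta := z + z ^+ 3)).
- by rewrite oppr_eq0 two_neq0_Fp.
- rewrite rmorphN rmorph_nat.
  have -> : (z + z ^+ 3) ^+ 2 = z ^+ 2 * (1 + z ^+ 4) + 2%:R * z ^+ 4 by ring.
  by rewrite z4; ring.
rewrite frobenius_sum2 // -exprM (expr_root8_mod l z4) (expr_root8_mod (3 * l) z4).
rewrite -modnMmr; have : (l %% 8 \in [:: 1; 3; 5; 7])%N by rewrite !inE; lia.
have z5 : z ^+ 5 = - z by rewrite -[5%N]/(4 + 1)%N exprD z4; ring.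
have z7 : z ^+ 7 = - z ^+ 3 by rewrite -[7%N]/(4 + 3)%N exprD z4; ring.
by rewrite !inE => /or4P[]/eqP->; rewrite /= ?z5 ?z7; ring.
Qed.

Lemma legendre_2 :
  (2%:R : 'F_l) ^+ l.-1./2 = (-1) ^+ ((l %% 8 == 3) || (l %% 8 == 5))%N.
Proof.
have [L [f charl]] := Fp_closure l_pr; have [z z4] := closed_root8 L.
apply: (euler_of_root (f := f) (eta := z - z ^+ 3)).
- by rewrite two_neq0_Fp.
- rewrite rmorph_nat.
  have -> : (z - z ^+ 3) ^+ 2 = z ^+ 2 * (1 + z ^+ 4) - 2%:R * z ^+ 4 by ring.
  by rewrite z4; ring.
have NX : (- z ^+ 3) ^+ l = - z ^+ (3 * l).
  by rewrite exprNn -signr_odd l_odd expr1 mulN1r exprM.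
rewrite frobenius_sum2 // NX (expr_root8_mod l z4) (expr_root8_mod (3 * l) z4).
rewrite -modnMmr; have : (l %% 8 \in [:: 1; 3; 5; 7])%N by rewrite !inE; lia.
have z5 : z ^+ 5 = - z by rewrite -[5%N]/(4 + 1)%N exprD z4; ring.
have z7 : z ^+ 7 = - z ^+ 3 by rewrite -[7%N]/(4 + 3)%N exprD z4; ring.
by rewrite !inE => /or4P[]/eqP->; rewrite /= ?z5 ?z7; ring.
Qed.

End Supplements.

(** * Jacobi sums of order 4 and 8 *)

Section Octic.

Variables (p : nat) (g : 'F_p).
Hypotheses (p_pr : prime p) (g_prim : p.-1.-primitive_root g) (p8 : (p %% 8 = 1)%N).

Let N := (p.-1 %/ 8)%N.

Lemma predp_octic : p.-1 = (8 * N)%N.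
Proof. by rewrite /N; move: (prime_gt0 p_pr) p8; clear; lia. Qed.

Lemma octic_odd : odd p.
Proof. by move: p8; clear; lia. Qed.

Let p_odd := octic_odd.

Lemma unity8_predp (R : comNzRingType) (z : R) : z ^+ 8 = 1 -> z ^+ p.-1 = 1.
Proof. by move=> z8; rewrite predp_octic exprM z8 expr1n. Qed.

Lemma root8_unity8 (R : comNzRingType) (z : R) : z ^+ 4 = -1 -> z ^+ 8 = 1.
Proof. by move=> z4; rewrite (expr_root8_mod 8 z4). Qed.

Lemma gen_root8 : (g ^+ N) ^+ 4 = -1.
Proof.
rewrite -exprM -(gen_half p_pr g_prim p_odd); congr (_ ^+ _).
by rewrite predp_octic; clear; lia.
Qed.

Lemma chi_quadratic_N1 (R : comNzRingType) : chi g (-1 : R) (-1) = 1.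
Proof.
rewrite -gen_root8 -[4%N]/(2 * 2)%N exprM chi_sqr //.
by rewrite -exprM expf_neq0 // (gen_neq0 g_prim).
Qed.

Lemma chi_quadratic_2 (R : comNzRingType) : chi g (-1 : R) 2%:R = 1.
Proof.
set s := g ^+ N; have s4 : s ^+ 4 = -1 := gen_root8.
have E : 2%:R = (s - s ^+ 3) ^+ 2.
  transitivity (s ^+ 2 * (1 + s ^+ 4) - 2%:R * s ^+ 4); last by ring.
  by rewrite s4; ring.
by rewrite {1}E chi_sqr // -sqrf_eq0 -E two_neq0_Fp.
Qed.

Section OcticGauss.

Variables (L : fieldType) (w z : L).
Hypotheses (wp : w ^+ p = 1) (wn1 : w != 1) (L2 : -1 != 1 :> L) (z4 : z ^+ 4 = -1).

(** G(z)^2 is G(z^2) times the Jacobi sum of chi z with itself, which is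
   chi z (4)^-1 times the Jacobi sum with the quadratic character. The factor
   chi z (4) disappears from the eighth power because 2 is a square mod p. *)
Lemma gauss_octic :
  gauss g w z ^+ 8 = jacobi g z (-1) ^+ 4 * jacobi g (z ^+ 2) (-1) ^+ 2 * p%:R.
Proof.
have z8 := root8_unity8 z4.
have z2n1 : z ^+ 2 != 1.
  by apply: contra_neq L2 => z2; rewrite -z4 -[4%N]/(2 * 2)%N exprM z2 expr1n.
have zn1 : z != 1 by apply: contra_neq z2n1 => ->; rewrite expr1n.
have z1 := unity8_predp z8.
have z21 : (z ^+ 2) ^+ p.-1 = 1 by rewrite exprAC z1 expr1n.
have N1 : (-1) ^+ p.-1 = 1 :> L := sign_predp L p_odd.
have z22 : z ^+ 2 * z ^+ 2 = -1 by rewrite -exprD.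
have g1 : gauss g w z ^+ 2 = jacobi g z z * gauss g w (z ^+ 2).
  by rewrite expr2 (gauss_jacobi p_pr g_prim) // expr2.
have g2 : gauss g w (z ^+ 2) ^+ 2 = jacobi g (z ^+ 2) (z ^+ 2) * gauss g w (-1).
  by rewrite expr2 (gauss_jacobi p_pr g_prim) // z22.
have g4 : gauss g w (-1) ^+ 2 = p%:R.
  by rewrite expr2 (gaussM_inv p_pr g_prim) // ?mulrNN ?mulr1 // chi_quadratic_N1 mul1r.
have D2 : chi g (z ^+ 2) 4%:R = 1.
  rewrite -[4%N]/(2 ^ 2)%N natrX chiX // expr2 -chiMl z22.
  exact: chi_quadratic_2.
have K1 := jacobi_diag p_pr g_prim p_odd z1 zn1.
have J1 := jacobi_diag p_pr g_prim p_odd z21 z2n1.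
rewrite D2 mul1r in J1; rewrite -K1 -J1 -g4.
have D : chi g z 4%:R ^+ 2 = 1 by rewrite expr2 -chiMl -expr2 D2.
transitivity ((gauss g w z ^+ 2) ^+ 4); first by rewrite -exprM.
rewrite g1 !exprMn.
have -> : chi g z 4%:R ^+ 4 = 1 by rewrite -[4%N]/(2 * 2)%N exprM D expr1n.
by rewrite mul1r -mulrA; congr (_ * _); rewrite -exprMn -g2 -exprM.
Qed.

End OcticGauss.

(** Expressing the Jacobi sums by Gauss sums, all Gauss sums occur in pairs of
   inverse characters. *)
Lemma jacobi_norm (L : fieldType) (w y z : L) : w ^+ p = 1 -> w != 1 ->
  p%:R != 0 :> L -> -1 != 1 :> L ->
  y ^+ 8 = 1 -> y * z = 1 -> y != 1 -> y != -1 ->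
  jacobi g y (-1) * jacobi g z (-1) = p%:R.
Proof.
move=> wp wn1 p0 L2 y8 yz yn1 ynN1.
have z8 : z ^+ 8 = 1 by rewrite -[LHS]mul1r -{1}y8 -exprMn yz expr1n.
have y1 := unity8_predp y8; have z1 := unity8_predp z8.
have N1 : (-1) ^+ p.-1 = 1 :> L := sign_predp L p_odd.
have Ny1 : (y * -1) ^+ p.-1 = 1 by rewrite exprMn y1 N1 mulr1.
have zN : z != -1 by apply: contra_neq ynN1 => zN; rewrite -yz zN mulrN1 opprK.
have zn1 : z != 1 by apply: contra_neq yn1 => z1'; rewrite -yz z1' mulr1.
have Nn (x : L) : x != -1 -> x * -1 != 1 by rewrite mulrN1 eqr_oppLR.
have ey := gauss_jacobi p_pr g_prim wp y1 N1 (Nn _ ynN1).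
have ez := gauss_jacobi p_pr g_prim wp z1 N1 (Nn _ zN).
have eN : gauss g w (y * -1) * gauss g w (z * -1) = chi g y (-1) * p%:R.
  rewrite (gaussM_inv p_pr g_prim) ?Nn //; first by rewrite chiMl chi_quadratic_N1 mulr1.
  by rewrite mulrACA yz mulrNN !mulr1.
have e1 : gauss g w y * gauss g w z = chi g y (-1) * p%:R.
  by rewrite (gaussM_inv p_pr g_prim).
have e4 : gauss g w (-1) * gauss g w (-1) = p%:R.
  by rewrite (gaussM_inv p_pr g_prim) ?mulrNN ?mulr1 // chi_quadratic_N1 mul1r.
have c0 : chi g y (-1) * p%:R != 0.
  by rewrite mulf_neq0 // chi_neq0 // oppr_eq0 oner_neq0.
apply: (mulIf c0); rewrite -{1}eN mulrACA -ey -ez mulrACA e1 e4; ring.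
Qed.

End Octic.

Section OcticCoordinates.

Variables (p : nat) (g : 'F_p).
Hypotheses (p_pr : prime p) (g_prim : p.-1.-primitive_root g) (p8 : (p %% 8 = 1)%N).

Let p_odd : odd p := octic_odd p8.

(** Grouping the terms of the Jacobi sum of chi z and the quadratic character by
   the value of chi z gives integers that do not depend on z, hence coordinates for
   these sums in all rings at once. *)
Definition octic_count (k : nat) : int :=
  \sum_(a : 'F_p | a != 0) (ind g a %% 8 == k)%N%:R * chi g (-1) (1 - a).

Lemma jacobi_count (R : comNzRingType) (z : R) : z ^+ 8 = 1 ->
  jacobi g z (-1) = \sum_(k < 8) z ^+ k * (octic_count k)%:~R.
Proof.
move=> z8; rewrite /jacobi (bigD1 0) //= chi0 mul0r add0r.
under [RHS]eq_bigr do rewrite rmorph_sum mulr_sumr.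
rewrite [RHS]exchange_big /=; apply: eq_bigr => a a0.
rewrite chi_ind // -(expr_mod _ z8).
have lt8 : (ind g a %% 8 < 8)%N by rewrite ltn_mod.
rewrite (bigD1 (Ordinal lt8)) //= eqxx mul1r big1 ?addr0 => [|k kn].
  by rewrite chi_morph rmorphN1.
rewrite (_ : (ind g a %% 8 == k)%N = false) ?mul0r ?rmorph0 ?mulr0 //.
by apply: contraNF kn => /eqP ek; apply/eqP/val_inj.
Qed.

Lemma ind_modM (a b : 'F_p) : a != 0 -> b != 0 ->
  (ind g (a * b)%R = ind g a + ind g b %[mod 8])%N.
Proof.
move=> a0 b0; have : g ^+ ind g (a * b) == g ^+ (ind g a + ind g b).
  by rewrite exprD !(indK p_pr g_prim) ?mulf_neq0.
rewrite (eq_prim_root_expr g_prim) (predp_octic p_pr p8) => /eqP e.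
have d8 : (8 %| 8 * (p.-1 %/ 8))%N by rewrite dvdn_mulr.
by rewrite -[LHS](modn_dvdm _ d8) e modn_dvdm.
Qed.

Lemma ind_gen k : (ind g (g ^+ k)%R = k %[mod 8])%N.
Proof.
have : g ^+ ind g (g ^+ k) == g ^+ k.
  by rewrite (indK p_pr g_prim) ?expf_neq0 ?(gen_neq0 g_prim).
rewrite (eq_prim_root_expr g_prim) (predp_octic p_pr p8) => /eqP e.
have d8 : (8 %| 8 * (p.-1 %/ 8))%N by rewrite dvdn_mulr.
by rewrite -[LHS](modn_dvdm _ d8) e modn_dvdm.
Qed.

(** Substitute 1/a for a, and use 1 - 1/a = - (1 - a)/a where -1 is a square. *)
Lemma octic_count_opp k k' : (k < 8)%N -> (k' < 8)%N -> (k + k' = 0 %[mod 8])%N ->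
  octic_count k' = (-1) ^+ k * octic_count k.
Proof.
move=> k8 k'8 kk'; rewrite /octic_count (reindex_inj invr_inj) mulr_sumr /=.
apply: eq_big => [a|a a0]; first by rewrite invr_eq0.
have a0' : a != 0 by rewrite -invr_eq0.
have e := ind_modM a0' a0; rewrite divff // in e.
have e1 : (ind g 1%R = 0 %[mod 8])%N by have := ind_gen 0; rewrite expr0.
have -> : (ind g (a^-1)%R %% 8 == k')%N = (ind g a %% 8 == k)%N.
  have {}e : ((ind g a %% 8 + ind g a^-1%R %% 8) %% 8 = 0)%N.
    by rewrite modnDm -e e1.
  move: (ltn_pmod (ind g a) (isT : 0 < 8)%N) (ltn_pmod (ind g a^-1) (isT : 0 < 8)%N).
  move: e kk' k8 k'8; clear; set i := (_ %% 8)%N; set j := (_ %% 8)%N.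
  by move=> *; apply/eqP/eqP; lia.
have [ek|_] := eqVneq (ind g a %% 8)%N k; last by rewrite !mul0r mulr0.
have N1 : (-1) ^+ p.-1 = 1 :> int := sign_predp int p_odd.
rewrite !mul1r.
have -> : 1 - a^-1 = -1 * (a^-1 * (1 - a)) by field.
rewrite !(chiM p_pr g_prim) // (chi_quadratic_N1 p_pr g_prim p8) mul1r; congr (_ * _).
have -> : chi g (-1) a^-1 = chi g (-1) a :> int.
  have e2 : chi g (-1) a * chi g (-1) a^-1 = 1 :> int.
    by rewrite -(chiM p_pr g_prim) // divff // (chi1 p_pr g_prim).
  have e3 : chi g (-1) a * chi g (-1) a = 1 :> int.
    by rewrite -(chiM p_pr g_prim) // -expr2 (chi_sqr p_pr g_prim p_odd).
  by have := congr1 ( *%R (chi g (-1) a)) e2; rewrite mulrA e3 mul1r mulr1.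
by rewrite chi_ind // -ek -[RHS]signr_odd odd_mod // signr_odd.
Qed.

Lemma octic_count_total : \sum_(k < 8) octic_count k = -1.
Proof.
have := jacobi_count (R := int) (expr1n _ 8); under eq_bigr do rewrite expr1n mul1r intz.
move=> <-; have N1 : (-1) ^+ p.-1 = 1 :> int := sign_predp int p_odd.
have := sum_chi p_pr g_prim N1 isT; rewrite (reindex_inj (inv_inj (subKr 1))) /=.
rewrite (bigD1 0) //= subr0 (chi1 p_pr g_prim) // => /eqP; rewrite addr_eq0 => /eqP e.
transitivity (\sum_(a : 'F_p | a != 0) chi g (-1 : int) (1 - a)).
  rewrite /jacobi (bigD1 0) //= chi0 mul0r add0r.
  by apply: eq_bigr => a a0; rewrite chi_one a0 mul1r.
by rewrite -[LHS]opprK -e.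
Qed.

(** Modulo 2 the sum of index k is the size of a class of eighth powers, except
   for k = 0, where the term a = 1 vanishes; all classes have the same size. *)
Lemma octic_count_parity : (octic_count 2%N = octic_count 4%N %[mod 2])%Z.
Proof.
have N11 : (-1 : 'F_2) = 1 by apply/val_inj.
have countF2 k : k \in [:: 2; 4]%N -> (octic_count k)%:~R =
    \sum_(a : 'F_p | a != 0) (ind g a %% 8 == k)%N%:R :> 'F_2.
  move=> k24; rewrite rmorph_sum; apply: eq_bigr => a a0.
  rewrite rmorphM chi_morph rmorphN1 N11 chi_one rmorph_nat.
  have [a1|a1] := eqVneq (1 - a) 0; last by rewrite mulr1.
  have -> : a = g ^+ 0 by rewrite expr0; move/eqP: a1; rewrite subr_eq0 => /eqP.
  by rewrite ind_gen; move: k24; rewrite !inE => /orP[]/eqP->; rewrite mul0r.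
apply/eqP; rewrite eqz_mod_dvd (dvdz_pcharf (pchar_Fp (isT : prime 2))).
rewrite intrB !countF2 ?inE // [X in _ - X](reindex_inj (mulfI (x := g ^+ 2) _)) /=.
  rewrite subr_eq0; apply/eqP/eq_big => [a|a a0].
    by rewrite mulf_eq0 negb_or expf_neq0 ?(gen_neq0 g_prim).
  rewrite ind_modM ?expf_neq0 ?(gen_neq0 g_prim) //; last first.
  rewrite -modnDml ind_gen modnDml; congr (_%:R); congr nat_of_bool.
  by move: (ind g a); clear => i; apply/eqP/eqP; lia.
by rewrite expf_neq0 ?(gen_neq0 g_prim).
Qed.

Lemma chi_gen_expr e a : (0 < e)%N -> chi g (g ^+ e) a = a ^+ e.
Proof.
move=> e0; have [->|a0] := eqVneq a 0; first by rewrite chi0 expr0n eqn0Ngt e0.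
by rewrite chi_ind // exprAC (indK p_pr g_prim).
Qed.

Lemma sum_expr_Fp e : (0 < e < p.-1)%N -> \sum_(a : 'F_p) a ^+ e = 0.
Proof.
move=> /andP[e0 ep]; under eq_bigr do rewrite -chi_gen_expr //.
apply: (sum_chi p_pr g_prim); first by rewrite exprAC (prim_expr_order g_prim) expr1n.
by rewrite -(prim_order_dvd g_prim) gtnNdvd.
Qed.

(** In F_p itself the characters are power maps, and the Jacobi sum is the sum over
   F_p of a polynomial without constant term of degree less than p - 1. *)
Lemma jacobi_mod_p :
  jacobi g ((g ^+ (p.-1 %/ 8)) ^+ 2) (-1) = 0 :> 'F_p.
Proof.
have pE := predp_octic p_pr p8; set N := (p.-1 %/ 8)%N in pE *.
have N0 : (0 < N)%N by move: (prime_gt1 p_pr) pE; clear; lia.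
rewrite /jacobi -exprM.
under eq_bigr => a _.
  rewrite chi_gen_expr ?muln_gt0 ?N0 // -(euler_chi p_pr g_prim p_odd).
  rewrite exprBn mulr_sumr; under eq_bigr do rewrite expr1n mulr1 mulrnAr mulrCA -exprD.
  over.
rewrite exchange_big big1 //= => i _; rewrite sumrMnl -mulr_sumr sum_expr_Fp ?mulr0 ?mul0rn //.
by move: (ltn_ord i) N0 pE; clear; lia.
Qed.

Lemma sum_ord8 (V : nmodType) (F : nat -> V) :
  \sum_(k < 8) F k = F 0%N + F 1%N + F 2%N + F 3%N + F 4%N + F 5%N + F 6%N + F 7%N.
Proof. by rewrite !big_ord_recr big_ord0 /= add0r. Qed.

(** With n_k the eight sums above, u = n_0 - n_4, v = n_1 + n_3,
   a = n_0 + n_4 - 2 n_2 and b = 2 (n_1 - n_3). The total n_0 + n_4 + 2 n_2 = -1 gives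
   a = -1 - 4 n_2 and u = -1 - 2 (n_2 + n_4), hence the residues modulo 4. The norms
   are computed among the algebraic numbers, where the integers embed. *)
Lemma jacobi_coordinates : exists u v a b : int,
  [/\ forall (R : comNzRingType) (z : R), z ^+ 4 = -1 ->
        jacobi g z (-1) = u%:~R + v%:~R * (z + z ^+ 3),
      forall (R : comNzRingType) (z : R), z ^+ 4 = -1 ->
        jacobi g (z ^+ 2) (-1) = a%:~R + b%:~R * z ^+ 2,
      (u = 3 %[mod 4])%Z & (a = 3 %[mod 4])%Z] /\
  [/\ p%:Z = u ^+ 2 + 2 * v ^+ 2, p%:Z = a ^+ 2 + b ^+ 2
    & a%:~R + b%:~R * (g ^+ (p.-1 %/ 8)) ^+ 2 = 0 :> 'F_p].
Proof.
pose n := octic_count.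
have n7 : n 7%N = - n 1%N by rewrite /n (@octic_count_opp 1 7) // mulN1r.
have n6 : n 6%N = n 2%N by rewrite /n (@octic_count_opp 2 6) // sqrrN expr1n mul1r.
have n5 : n 5%N = - n 3%N by rewrite /n (@octic_count_opp 3 5) // -signr_odd mulN1r.
have tot := octic_count_total; have par := octic_count_parity.
rewrite sum_ord8 -/n n7 n6 n5 in tot; rewrite -/n in par.
have K (R : comNzRingType) (z : R) : z ^+ 4 = -1 ->
    jacobi g z (-1) = (n 0%N - n 4%N)%:~R + (n 1%N + n 3%N)%:~R * (z + z ^+ 3).
  move=> z4; rewrite (jacobi_count (root8_unity8 z4)).
  rewrite (sum_ord8 (fun k => z ^+ k * (n k)%:~R)).
  have [z5 z6 z7] := root8_powers z4; rewrite n7 n6 n5 z4 z5 z6 z7; ring.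
have J (R : comNzRingType) (z : R) : z ^+ 4 = -1 ->
    jacobi g (z ^+ 2) (-1) = (n 0%N + n 4%N - 2 * n 2%N)%:~R + (2 * (n 1%N - n 3%N))%:~R * z ^+ 2.
  move=> z4; have z28 : (z ^+ 2) ^+ 8 = 1 by rewrite exprAC root8_unity8 ?expr1n.
  rewrite (jacobi_count z28) (sum_ord8 (fun k => z ^+ 2 ^+ k * (n k)%:~R)).
  have y2 : (z ^+ 2) ^+ 2 = -1 by rewrite -exprM.
  move: (z ^+ 2) y2 => y y2; have y4 : y ^+ 4 = 1 by rewrite (exprM y 2 2) y2 sqrrN expr1n.
  rewrite n7 n6 n5 (exprD y 4 3) (exprD y 4 2) (exprD y 4 1) (exprD y 2 1) y4 y2.
  ring.
exists (n 0%N - n 4%N); exists (n 1%N + n 3%N); exists (n 0%N + n 4%N - 2 * n 2%N).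
exists (2 * (n 1%N - n 3%N)).
have C4 : (-1 : algC) != 1 by rewrite eq_sym -subr_eq0 opprK -[1 + 1]/(2%:R) pnatr_eq0.
have p0 : p%:R != 0 :> algC by rewrite pnatr_eq0 -lt0n prime_gt0.
have [w [wp wn1]] := closed_root_of_unity p_pr p0.
have [z z4] := closed_root8 algC; have z8 := root8_unity8 z4.
have [z5 z6 z7] := root8_powers z4.
have zy : z * (- z ^+ 3) = 1 by rewrite mulrN -exprS z4 opprK.
have z74 : (- z ^+ 3) ^+ 4 = -1 by rewrite -z7 exprAC z4 -signr_odd expr1.
have z2n1 : z ^+ 2 != 1.
  by apply: contra_neq C4 => z2; rewrite -z4 (exprM z 2 2) z2 expr1n.
have z2nN1 : z ^+ 2 != -1.
  by apply: contra_neq C4 => z2; rewrite -z4 (exprM z 2 2) z2 sqrrN expr1n.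
have intC (i j : int) : i%:~R = j%:~R :> algC -> i = j by move/intr_inj.
split; split => //.
- by move: tot par; clear; lia.
- by move: tot par; clear; lia.
- apply: intC; rewrite -pmulrn.
  have zn1 : z != 1 by apply: contra_neq z2n1 => ->; rewrite expr1n.
  have znN1 : z != -1 by apply: contra_neq z2n1 => ->; rewrite sqrrN expr1n.
  rewrite -(jacobi_norm p_pr g_prim p8 wp wn1 p0 C4 z8 zy zn1 znN1) !K //.
  have -> : (- z ^+ 3) ^+ 3 = - z.
    by rewrite -z7 -exprM (expr_root8_mod _ z4) -[(_ %% _)%N]/5%N z5.
  have e2 : (z + z ^+ 3) ^+ 2 = - 2%:R.
    transitivity (z ^+ 2 + 2%:R * z ^+ 4 + z ^+ 6); first by ring.
    by rewrite z4 z6; ring.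
  set U := (n 0%N - n 4%N); set V := (n 1%N + n 3%N).
  transitivity (U%:~R ^+ 2 - V%:~R ^+ 2 * (z + z ^+ 3) ^+ 2); first by ring.
  by rewrite e2; ring.
- apply: intC; rewrite -pmulrn.
  have z28 : (z ^+ 2) ^+ 8 = 1 by rewrite exprAC z8 expr1n.
  have zy2 : z ^+ 2 * (- z ^+ 3) ^+ 2 = 1 by rewrite -exprMn zy expr1n.
  rewrite -(jacobi_norm p_pr g_prim p8 wp wn1 p0 C4 z28 zy2 z2n1 z2nN1) !J //.
  have -> : (- z ^+ 3) ^+ 2 = - z ^+ 2 by rewrite sqrrN -exprM z6.
  set A := (_ - _); set B := (2 * _).
  transitivity (A%:~R ^+ 2 - B%:~R ^+ 2 * z ^+ 4); first by ring.
  by rewrite z4; ring.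
by have := J _ _ (gen_root8 p_pr g_prim p8); rewrite jacobi_mod_p => <-.
Qed.

End OcticCoordinates.

(** * Signs of representations by binary quadratic forms *)

(** Meant for properties like the agreement of two quadratic characters at n, which
   hold at squares for trivial reasons. *)
Lemma odd_exponent_ind (T : nat -> Prop) (n : nat) : (0 < n)%N ->
  T 1%N -> (forall a b, T a -> T b -> T (a * b)%N) ->
  (forall l, prime l -> (l %| n)%N -> T (l ^ 2)%N) ->
  (forall l, prime l -> odd (logn l n) -> T l) -> T n.
Proof.
move=> n0 T1 TM Tsq Todd.
rewrite (prod_prime_decomp n0) prime_decompE big_map big_seq /=.
apply: (big_ind T) => // l; rewrite mem_primes => /and3P[l_pr _ ln].
have TX t k : T t -> T (t ^ k)%N.
  by move=> Tt; elim: k => [|k IHk]; rewrite ?expn0 // expnS; apply: TM.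
rewrite -(odd_double_half (logn l n)) expnD -mul2n expnM.
apply: TM; last exact/TX/Tsq.
by case: (boolP (odd _)) => [/(Todd l l_pr)|]; rewrite ?expn1 ?expn0.
Qed.

Lemma intF_eq0 (l : nat) (n : int) : prime l -> (n%:~R == 0 :> 'F_l) = (l %| n)%Z.
Proof. by move=> l_pr; rewrite -(dvdz_pcharf (pchar_Fp l_pr)). Qed.

(** If N is not a square modulo l then l divides a^2 - N b^2 only if it divides a
   and b, so that its exponent is even, by descent. The last hypothesis on l puts
   this whole exponent into A. *)
Lemma odd_logn_square (N A B a b : int) (l : nat) : prime l ->
  A * B = a ^+ 2 - N * b ^+ 2 -> b != 0 -> odd (logn l `|A|) ->
  ~~ [&& l %| A, l %| B, l %| a & l %| b]%Z ->
  exists t : 'F_l, N%:~R = t ^+ 2.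
Proof.
move=> l_pr; have [k] := ubnP `|b|%N; elim: k => // k IHk in A B a b *.
move=> ltk E b0 oA nAll.
have lA : (l %| A)%Z.
  apply: contraLR oA => nl; rewrite lognE (_ : (l %| `|A|)%N = false) ?andbF //.
  exact: negbTE.
have [lb|lb] := boolP (l %| b)%Z; last first.
  exists ((a%:~R : 'F_l) / b%:~R); rewrite expr_div_n.
  have bF : b%:~R != 0 :> 'F_l by rewrite intF_eq0.
  have := congr1 (fun x : int => x%:~R : 'F_l) E.
  have /eqP A0 : A%:~R == 0 :> 'F_l by rewrite intF_eq0.
  rewrite /= intrM A0 mul0r => /esym/eqP.
  rewrite intrB [(N * _)%:~R]intrM !rmorphXn /= subr_eq0 => /eqP ->.
  by rewrite mulfK // expf_neq0.
have la : (l %| a)%Z.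
  have : (l %| a ^+ 2)%Z.
    have -> : a ^+ 2 = A * B + N * b * b by rewrite E; ring.
    by apply: rpredD; [exact: dvdz_mulr | exact: dvdz_mull].
  by rewrite expr2 !dvdzE abszM Euclid_dvdM ?absz_nat // orbb.
have nB : ~~ (l %| B)%Z by move: nAll; rewrite lA la lb !andbT.
have /dvdzP[a' a'E] := la; have /dvdzP[b' b'E] := lb.
have l2A : (l%:Z ^+ 2 %| A)%Z.
  have : (l%:Z ^+ 2 %| A * B)%Z.
    rewrite E a'E b'E; apply/dvdzP; exists (a' ^+ 2 - N * b' ^+ 2); ring.
  rewrite Gauss_dvdzl // coprimez_pexpl // coprimezE /=.
  by rewrite prime_coprime.
have /dvdzP[A' A'E] := l2A.
have A0 : A' != 0.
  by apply: contraTneq oA => A'0; rewrite A'E A'0 mul0r logn0.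
have b'0 : b' != 0 by apply: contraNneq b0 => b'0; rewrite b'E b'0 mul0r.
have lt0 : l%:Z != 0 by rewrite -lt0n prime_gt0.
apply: (IHk A' B a' b') => //.
- move: ltk; rewrite ltnS b'E abszM; apply: leq_trans => /=.
  by rewrite ltn_Pmulr ?prime_gt1 // lt0n absz_eq0.
- apply: (mulfI (expf_neq0 2 lt0)); transitivity (A * B); first by rewrite A'E; ring.
  by rewrite E a'E b'E; ring.
- move: oA; rewrite A'E abszM abszX lognM ?absz_gt0 ?expn_gt0 ?prime_gt0 //=.
  by rewrite pfactorK // addn2 /= negbK.
- by rewrite (negPf nB) andbF.
Qed.

(** The signs (-1)^(kappa4 m) and (-1)^(kappa8 m) of an odd number m are the Jacobi
   symbols (-1/m) and (-2/m), extended to negative m so that -1 has sign -1. *)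
Definition kappa4 (m : int) : bool := (m %% 4 == 3)%Z.
Definition kappa8 (m : int) : bool := ((m %% 8 == 5) || (m %% 8 == 7))%Z.

Lemma odd_residue8 (m : int) : (m %% 2 = 1)%Z ->
  exists k r : int, m = 8 * k + r /\ r \in [:: 1; 3; 5; 7].
Proof.
move=> m1; exists (m %/ 8)%Z; exists (m %% 8)%Z; rewrite !inE; split; lia.
Qed.

Lemma kappa4M (m n : int) : (m %% 2 = 1)%Z -> (n %% 2 = 1)%Z ->
  kappa4 (m * n) = kappa4 m (+) kappa4 n.
Proof.
move=> /odd_residue8[i [r [-> hr]]] /odd_residue8[j [s [-> hs]]].
have -> : (8 * i + r) * (8 * j + s) = 8 * (8 * (i * j) + i * s + j * r) + r * s.
  by ring.
move: hr hs; set k := _ + j * r; move: k => k; rewrite /kappa4 !inE.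
by do 2![case/or4P => /eqP ->]; lia.
Qed.

Lemma kappa8M (m n : int) : (m %% 2 = 1)%Z -> (n %% 2 = 1)%Z ->
  kappa8 (m * n) = kappa8 m (+) kappa8 n.
Proof.
move=> /odd_residue8[i [r [-> hr]]] /odd_residue8[j [s [-> hs]]].
have -> : (8 * i + r) * (8 * j + s) = 8 * (8 * (i * j) + i * s + j * r) + r * s.
  by ring.
move: hr hs; set k := _ + j * r; move: k => k; rewrite /kappa8 !inE.
by do 2![case/or4P => /eqP ->]; lia.
Qed.

Lemma sign_injF (l : nat) (b c : bool) : prime l -> odd l ->
  (-1) ^+ b = (-1) ^+ c :> 'F_l -> b = c.
Proof.
move=> l_pr l_odd; have := Fp_oppr1_neq1 l_pr l_odd.
by case: b c => [] [] // /eqP n1; rewrite expr1 expr0 // => e; case: n1.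
Qed.

Section LegendreForms.

Variable q : nat.
Hypotheses (q_pr : prime q) (q8 : (q %% 8 = 7)%N).

Lemma odd_7mod8 : odd q. Proof. by move: q8; clear; lia. Qed.
Let q_odd := odd_7mod8.

Lemma legendre_neg1_7mod8 : (-1 : 'F_q) ^+ q.-1./2 = -1.
Proof.
by rewrite -signr_odd (_ : odd _ = true) ?expr1 //; move: q8; clear; lia.
Qed.

Lemma legendre_2_7mod8 : (2%:R : 'F_q) ^+ q.-1./2 = 1.
Proof. by rewrite legendre_2 // q8. Qed.

Lemma legendre_sqr (a : 'F_q) : a != 0 -> (a ^+ 2) ^+ q.-1./2 = 1.
Proof. by move=> a0; rewrite -exprM double_half_predp // Fp_fermat. Qed.

(** The sign (-1)^kappa is a multiplicative substitute for the Legendre symbol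
   modulo q: they agree at -1 and at the odd primes modulo which N is a square. *)
Definition legendre_char (N : int) (kappa : int -> bool) :=
  [/\ forall m n, (m %% 2 = 1)%Z -> (n %% 2 = 1)%Z ->
        kappa (m * n) = kappa m (+) kappa n,
      kappa (-1)
    & forall l (t : 'F_l), prime l -> odd l -> l != q -> N%:~R = t ^+ 2 ->
        (l%:R : 'F_q) ^+ q.-1./2 = (-1) ^+ kappa l].

(** If q is a square modulo l, the symbol of -q modulo l is that of -1. *)
Lemma legendre_char_q : legendre_char q kappa4.
Proof.
split=> [||l t l_pr l_odd lq Nt]; [exact: kappa4M | by [] |].
have q4 : (q %% 4 = 3)%N by move: q8; clear; lia.
have ql : q != l by rewrite eq_sym.
have [b [-> e]] := quadratic_reciprocity q_pr l_pr q_odd l_odd ql q4.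
have t0 : t != 0.
  rewrite -sqrf_eq0 -Nt -pmulrn -(dvdn_pcharf (pchar_Fp l_pr)) dvdn_prime2 //.
suff -> : b = kappa4 l by [].
apply: (sign_injF l_pr l_odd); rewrite -e.
rewrite -mulN1r exprMn [X in _ * X ^+ _]Nt -exprM double_half_predp // Fp_fermat // mulr1.
rewrite -[LHS]signr_odd; suff -> : odd l.-1./2 = kappa4 l by [].
by rewrite /kappa4; move: l_odd; clear; lia.
Qed.

(** If 2q is a square modulo l, the symbol of -q modulo l is that of -2. *)
Lemma legendre_char_2q : legendre_char (2 * q%:Z) kappa8.
Proof.
split=> [||l t l_pr l_odd lq Nt]; [exact: kappa8M | by [] |].
have q4 : (q %% 4 = 3)%N by move: q8; clear; lia.
have ql : q != l by rewrite eq_sym.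
have [b [-> e]] := quadratic_reciprocity q_pr l_pr q_odd l_odd ql q4.
have two0 := two_neq0_Fp l_pr l_odd.
have {}Nt : 2%:R * q%:R = t ^+ 2 by rewrite -Nt intrM.
have t0 : t != 0.
  rewrite -sqrf_eq0 -Nt mulf_neq0 // -(dvdn_pcharf (pchar_Fp l_pr)) dvdn_prime2 //.
suff -> : b = kappa8 l by [].
apply: (sign_injF l_pr l_odd); rewrite -e.
have : (- q%:R * 2%:R ^+ 2) ^+ l.-1./2 = (- 2%:R * t ^+ 2) ^+ l.-1./2 :> 'F_l.
  by rewrite -Nt; congr (_ ^+ _); ring.
rewrite exprMn [X in _ = X -> _]exprMn -!exprM double_half_predp // !Fp_fermat // !mulr1 => ->.
rewrite legendre_neg2 //; set c := (_ || _); suff -> : c = kappa8 l by [].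
by rewrite /c /kappa8; clear; lia.
Qed.

(** By multiplicativity: N is a square modulo the prime divisors of m of odd
   exponent, and both symbols are trivial on squares. *)
Lemma legendre_of_form (N : int) (kappa : int -> bool) (m B a b : int) :
  legendre_char N kappa -> (m %% 2 = 1)%Z -> b != 0 -> ~~ (q %| m)%Z ->
  m * B = a ^+ 2 - N * b ^+ 2 ->
  (forall l, prime l -> odd l -> ~~ [&& l %| m, l %| B, l %| a & l %| b]%Z) ->
  (m%:~R : 'F_q) ^+ q.-1./2 = (-1) ^+ kappa m.
Proof.
move=> [kM kN1 kP] m1 b0 qm E cop.
pose T (n : nat) := (n%:Z %% 2 = 1)%Z /\ (n%:R : 'F_q) ^+ q.-1./2 = (-1) ^+ kappa n.
have k1 : kappa 1 = false.
  by have := kM (-1) (-1) erefl erefl; rewrite mulrNN mulr1 kN1.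
have TM x y : T x -> T y -> T (x * y)%N.
  case=> x1 ex [y1 ey]; split; first by move: x1 y1; clear; lia.
  by rewrite natrM exprMn ex ey PoszM kM // signr_addb.
have m0 : (0 < `|m|)%N by rewrite absz_gt0; apply: contra_eq_neq m1 => ->.
have m_odd : odd `|m| by move: m1; clear; lia.
have qabs : ~~ (q %| `|m|)%N by [].
have Tm : T `|m|%N.
  apply: odd_exponent_ind => // [|l l_pr lm|l l_pr ol].
  - by split; rewrite ?k1 ?expr1n.
  - have l1 : (l%:Z %% 2 = 1)%Z by move: (dvdn_odd lm m_odd); clear; lia.
    split; first by rewrite expnS expn1; move: l1; clear; nia.
    rewrite natrX legendre_sqr ?mulnn; last first.
      rewrite -(dvdn_pcharf (pchar_Fp q_pr)).
      by apply: contra qabs => ql; apply: dvdn_trans lm.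
    by rewrite expnS expn1 PoszM kM // addbb.
  have lm : (l %| `|m|)%N by move: ol; rewrite lognE; case: (l %| _)%N; rewrite // !andbF.
  have l1 : (l%:Z %% 2 = 1)%Z by move: (dvdn_odd lm m_odd); clear; lia.
  have l_odd : odd l by move: l1; clear; lia.
  have [t Nt] := odd_logn_square l_pr E b0 ol (cop l l_pr l_odd).
  split=> //; apply: (kP l t) => //.
  by apply: contraNneq qabs => <-.
case: Tm => _; have [hm|hm] := leP 0 m.
  have mE : m = `|m|%N by rewrite gez0_abs.
  by move=> e; rewrite mE -pmulrn.
have mE : m = - (`|m|%N)%:Z by rewrite ltz0_abs // opprK.
move=> e; rewrite mE mulrNz -pmulrn -[- (`|m|%N)%:R]mulN1r exprMn legendre_neg1_7mod8 e.
by rewrite -[- _%:Z]mulN1r kM // ?kN1 ?signr_addb ?expr1 //; move: m_odd; clear; lia.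
Qed.

End LegendreForms.

Lemma sqr_mod8 (a : int) :
  (exists k, a = 2 * k) \/ (exists k, a ^+ 2 = 8 * k + 1).
Proof.
have [k [r [aE hr]]] : exists k r : int, a = 4 * k + r /\ r \in [:: 0; 1; 2; 3].
  by exists (a %/ 4)%Z; exists (a %% 4)%Z; rewrite !inE; split; lia.
move: hr; rewrite aE !inE => /or4P[]/eqP ->; [left|right|left|right].
- by exists (2 * k); ring.
- by exists (2 * k ^+ 2 + k); ring.
- by exists (2 * k + 1); ring.
- by exists (2 * k ^+ 2 + 3 * k + 1); ring.
Qed.

Section TwoAdic.

Variable q : nat.
Hypothesis q8 : (q %% 8 = 7)%N.

Let q_form : exists k : int, q%:Z = 8 * k + 7.
Proof. by exists (q %/ 8)%N%:Z; move: q8; clear; lia. Qed.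

(** Descent on j. If j is 0 or 1 the residues of the squares modulo 8 give m modulo
   4; if j is at least 2 then a and b are even. *)
Lemma kappa4_form (j : nat) (m a b : int) : (m %% 2 = 1)%Z ->
  2 ^+ j * m = a ^+ 2 - q%:Z * b ^+ 2 -> kappa4 m = false.
Proof.
move=> m1; have [k kq] := q_form.
have [n] := ubnP j; elim: n => // n IHn in j a b *; rewrite ltnS => jn.
have [[s sE]|[s sE]] := sqr_mod8 a; have [[t tE]|[t tE]] := sqr_mod8 b.
- case: j jn => [|[|j]] jn E.
  + rewrite sE tE expr0 mul1r in E; move: m1; rewrite E.
    have -> : (2 * s) ^+ 2 - q%:Z * (2 * t) ^+ 2 = 2 * (2 * s ^+ 2 - q%:Z * 2 * t ^+ 2) by ring.
    by clear; lia.
  + rewrite sE tE expr1 in E; move: m1; have -> : m = 2 * (s ^+ 2 - q%:Z * t ^+ 2).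
      by apply: (mulfI (isT : 2 != 0 :> int)); rewrite E; ring.
    by clear; lia.
  apply: (IHn j s t); first by apply: ltn_trans jn.
  apply: (mulfI (isT : 4 != 0 :> int)); transitivity (2 ^+ j.+2 * m).
    by rewrite !exprS; ring.
  by rewrite E sE tE; ring.
- case: j jn => [|j] _ E.
  + move: E; rewrite sE tE kq => E.
    have {}E : m = 4 * (s ^+ 2 - 2 * (8 * k + 7) * t - 2 * k - 2) + 1.
      by rewrite -[m]mul1r -[1 * m]/(2 ^+ 0 * m) E; ring.
    by rewrite /kappa4 E; clear; lia.
  exfalso; move: E; rewrite sE tE kq exprS => E.
  have : 2 * (2 ^+ j * m) = 2 * (2 * s ^+ 2 - (8 * k + 7) * 4 * t - 4 * k - 4) + 1.
    by rewrite mulrA E; ring.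
  by clear; lia.
- case: j jn => [|j] _ E.
  + move: E; rewrite sE tE => E.
    have {}E : m = 4 * (2 * s - q%:Z * t ^+ 2) + 1.
      by rewrite -[m]mul1r -[1 * m]/(2 ^+ 0 * m) E; ring.
    by rewrite /kappa4 E; clear; lia.
  exfalso; move: E; rewrite sE tE exprS => E.
  have : 2 * (2 ^+ j * m) = 2 * (4 * s - q%:Z * 2 * t ^+ 2) + 1.
    by rewrite mulrA E; ring.
  by clear; lia.
have [w wE] : exists w, a ^+ 2 - q%:Z * b ^+ 2 = 8 * w + 2.
  by exists (s - (8 * k + 7) * t - k - 1); rewrite sE tE kq; ring.
rewrite wE; case: j jn => [|[|j]] _.
- by rewrite expr0 mul1r => E; move: m1; rewrite E; clear; lia.
- by rewrite expr1 /kappa4 => E; move: E; clear; lia.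
rewrite !exprS !mulrA => E; exfalso; move: E.
by rewrite -!mulrA; clear; move: (_ * m) => v; lia.
Qed.

(** Descent on j again, in two steps: a is even when j > 0, and then
   2^(j-1) m = 2 (a/2)^2 - q b^2 with b even when j > 1. *)
Lemma kappa8_form (j : nat) (m a b : int) : (m %% 2 = 1)%Z ->
  2 ^+ j * m = a ^+ 2 - 2 * q%:Z * b ^+ 2 -> kappa8 m = false.
Proof.
move=> m1; have [k kq] := q_form.
have [n] := ubnP j; elim: n => // n IHn in j a b *; rewrite ltnS => jn.
have [[s sE]|[s sE]] := sqr_mod8 a; last first.
  case: j jn => [|j] _ E; last first.
    exfalso; move: E; rewrite sE exprS -mulrA => E.
    have : 2 * (2 ^+ j * m + q%:Z * b ^+ 2 - 4 * s) = 1.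
      by rewrite !(mulrBr, mulrDr) E; ring.
    by clear; lia.
  rewrite expr0 mul1r sE in E; rewrite /kappa8 E.
  have [[t ->]|[t ->]] := sqr_mod8 b.
    have -> : 8 * s + 1 - 2 * q%:Z * (2 * t) ^+ 2 = 8 * (s - q%:Z * t ^+ 2) + 1 by ring.
    by clear; lia.
  rewrite kq; have -> : 8 * s + 1 - 2 * (8 * k + 7) * (8 * t + 1) =
    8 * (s - 2 * (8 * k + 7) * t - 2 * k - 2) + 3 by ring.
  by clear; lia.
case: j jn => [|j] jn E.
  exfalso; move: m1; rewrite -[m]mul1r -[1 * m]/(2 ^+ 0 * m) E sE.
  have -> : (2 * s) ^+ 2 - 2 * q%:Z * b ^+ 2 = 2 * (2 * s ^+ 2 - q%:Z * b ^+ 2) by ring.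
  by clear; lia.
have {}E : 2 ^+ j * m = 2 * s ^+ 2 - q%:Z * b ^+ 2.
  apply: (mulfI (isT : 2 != 0 :> int)); transitivity (2 ^+ j.+1 * m).
    by rewrite exprS; ring.
  by rewrite E sE; ring.
have [[t tE]|[t tE]] := sqr_mod8 b; case: j jn E => [|j] jn E.
- exfalso; move: m1; rewrite -[m]mul1r -[1 * m]/(2 ^+ 0 * m) E tE.
  have -> : 2 * s ^+ 2 - q%:Z * (2 * t) ^+ 2 = 2 * (s ^+ 2 - q%:Z * 2 * t ^+ 2) by ring.
  by clear; lia.
- apply: (IHn j s t); first by apply: ltn_trans jn.
  apply: (mulfI (isT : 2 != 0 :> int)); transitivity (2 ^+ j.+1 * m).
    by rewrite exprS; ring.
  by rewrite E tE; ring.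
- rewrite expr0 mul1r tE kq in E; rewrite /kappa8 E.
  have [[u ->]|[u ->]] := sqr_mod8 s.
    have -> : 2 * (2 * u) ^+ 2 - (8 * k + 7) * (8 * t + 1) =
      8 * (u ^+ 2 - (8 * k + 7) * t - k - 1) + 1 by ring.
    by clear; lia.
  have -> : 2 * (8 * u + 1) - (8 * k + 7) * (8 * t + 1) =
    8 * (2 * u - (8 * k + 7) * t - k - 1) + 3 by ring.
  by clear; lia.
exfalso; move: E; rewrite tE kq exprS -mulrA => E.
have : 2 * (2 ^+ j * m - s ^+ 2 + (8 * k + 7) * 4 * t + 4 * k + 3) + 1 = 0.
  by rewrite !(mulrBr, mulrDr) E; ring.
by clear; lia.
Qed.

End TwoAdic.

Lemma odd_part_int (n : int) : n != 0 ->
  exists (k : nat) (m : int), n = 2 ^+ k * m /\ (m %% 2 = 1)%Z.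
Proof.
have [k] := ubnP `|n|%N; elim: k => // k IHk in n *; rewrite ltnS => nk n0.
have [[s sE]|[s sE]] := sqr_mod8 n; last first.
  exists 0%N; exists n; rewrite mul1r; split=> //.
  have [//|n2] : (n %% 2 = 1)%Z \/ (n %% 2 = 0)%Z by lia.
  have [w wE] : exists w, n = 2 * w by exists (n %/ 2)%Z; lia.
  have : 2 * (2 * w ^+ 2) = 8 * s + 1 by rewrite -sE wE; ring.
  by clear; lia.
have s0 : s != 0 by apply: contraNneq n0 => s0; rewrite sE s0 mulr0.
have [|j [m [mE m1]]] := IHk s _ s0; first by move: nk s0; rewrite sE; clear; lia.
by exists j.+1; exists m; rewrite exprS sE mE mulrA.
Qed.

Section HalfPower.

Variables (q : nat) (L : fieldType) (f : {rmorphism 'F_q -> L}).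
Hypotheses (q_pr : prime q) (q8 : (q %% 8 = 7)%N) (charq : q \in [pchar L]).

Let q_odd : odd q := odd_7mod8 q8.

Lemma intL_eq0 (n : int) : (n%:~R == 0 :> L) = (q %| n)%Z.
Proof. by rewrite (dvdz_pcharf charq). Qed.

Lemma frobenius_int (n : int) : n%:~R ^+ q = n%:~R :> L.
Proof. by rewrite -(pFrobenius_autE charq) rmorph_int. Qed.

(** (Z + x)^2 = 2 (c + x) Z, whereas (Z + x)^(q+1) = (Z + x)(Z' + x) = 2 x (c + x). *)
Lemma half_power (Z Z' : L) (c x : int) :
  Z ^+ q = Z' -> Z * Z' = x%:~R ^+ 2 -> Z + Z' = 2%:R * c%:~R ->
  ~~ (q %| x + c)%Z ->
  x%:~R = (2 * (x + c))%:~R ^+ q.-1./2 * Z ^+ (q.-1./2).+1.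
Proof.
move=> ZF Zn Zt qxc; set h := q.-1./2; set y := 2 * (x + c).
have qE : q = (2 * h).+1 by rewrite double_half_predp // prednK ?prime_gt0.
have y0 : y%:~R != 0 :> L.
  rewrite intL_eq0 dvdzE abszM Euclid_dvdM // negb_or; apply/andP; split; last by [].
  by rewrite gtnNdvd //; move: q8; clear; case: (q) => [|[|[|]]].
have sqE : (Z + x%:~R) ^+ 2 = y%:~R * Z.
  transitivity (Z * (Z + 2%:R * x%:~R) + x%:~R ^+ 2); first by ring.
  rewrite -Zn; transitivity (Z * (Z + Z' + 2%:R * x%:~R)); first by ring.
  by rewrite Zt /y; ring.
apply: (mulfI y0); transitivity ((Z + x%:~R) ^+ q * (Z + x%:~R)).
  rewrite frobenius_sum2 // ZF frobenius_int.
  transitivity (Z * Z' + (Z + Z') * x%:~R + x%:~R ^+ 2); last by ring.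
  by rewrite Zn Zt /y; ring.
rewrite -exprSr mulrA -exprS -exprMn -sqE -exprM; congr (_ ^+ _).
by rewrite {1}qE; clear; lia.
Qed.

(** If q does not divide x + c, the sign is the symbol of m. Otherwise -x takes the
   place of x, and the sign is that of the odd part n of x - c; the two signs agree
   since m n is, up to a power of 2, a value of the form a^2 - N b^2. *)
Lemma half_power_sign (N : int) (kappa : int -> bool) (Z Z' : L) (e : nat)
    (x c m a b : int) :
  legendre_char q N kappa ->
  (forall j n a b, (n %% 2 = 1)%Z -> 2 ^+ j * n = a ^+ 2 - N * b ^+ 2 ->
     kappa n = false) ->
  x + c = 2 * m -> (m %% 2 = 1)%Z ->
  2 ^+ e * ((x + c) * (x - c)) = a ^+ 2 - N * b ^+ 2 -> b != 0 ->
  (forall l, prime l -> odd l -> ~~ ((l %| x) && (l %| b))%Z) ->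
  ~~ (q %| x)%Z ->
  Z ^+ q = Z' -> Z * Z' = x%:~R ^+ 2 -> Z + Z' = 2%:R * c%:~R ->
  Z ^+ (q.-1./2).+1 = (-1) ^+ kappa m * x%:~R.
Proof.
move=> kN kD xc m1 E b0 cop qx ZF Zn Zt; set h := q.-1./2.
have dvd2 l (n : int) k : prime l -> odd l -> (l %| 2 ^+ k * n)%Z -> (l %| n)%Z.
  move=> l_pr l_odd; rewrite !dvdzE abszM abszX Gauss_dvdr // coprimeXr //=.
  by rewrite coprime_sym coprime2n.
have leg (n B : int) : (n %% 2 = 1)%Z -> ~~ (q %| n)%Z ->
    n * B = a ^+ 2 - N * b ^+ 2 ->
    (forall l, prime l -> odd l -> (l %| n)%Z -> (l %| B)%Z -> (l %| x)%Z) ->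
    n%:~R ^+ h = (-1) ^+ kappa n :> L.
  move=> n1 qn nB nx; rewrite -(rmorph_int f) -rmorphXn.
  rewrite (legendre_of_form q_pr q8 kN n1 b0 qn nB) ?rmorphXn ?rmorphN1 // => l l_pr l_odd.
  apply: contra (cop l l_pr l_odd) => /and4P[ln lB la lb].
  by rewrite lb nx.
have two1 k : (2 ^+ k)%:~R ^+ h = 1 :> L.
  rewrite -(rmorph_int f) -rmorphXn.
  have -> : (2 ^+ k)%:~R = 2%:R ^+ k :> 'F_q by rewrite rmorphXn.
  by rewrite exprAC legendre_2_7mod8 // expr1n rmorph1.
have sumx l (y z : int) : prime l -> odd l -> (l %| y)%Z -> (l %| z)%Z ->
    y + z = 2 * x -> (l %| x)%Z.
  by move=> l_pr l_odd ly lz yz; apply: (dvd2 l x 1%N); rewrite // expr1 -yz rpredD.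
have [qxc|qxc] := boolP (q %| x + c)%Z; last first.
  have qm : ~~ (q %| m)%Z by apply: contra qxc => qm; rewrite xc dvdz_mull.
  have := half_power ZF Zn Zt qxc; rewrite -/h.
  have -> : (2 * (x + c))%:~R = (2 ^+ 2)%:~R * m%:~R :> L by rewrite xc -intrM; congr _%:~R; ring.
  rewrite exprMn two1 mul1r (leg m (2 ^+ e.+1 * (x - c))) // => [->||].
  - by rewrite mulrA -signr_addb addbb mul1r.
  - by rewrite -E xc exprS; ring.
  move=> l l_pr l_odd lm /dvd2 lB; apply: (sumx l (x + c) (x - c)) => //.
  - by rewrite xc dvdz_mull.
  - exact: lB.
  by ring.
have qxc' : ~~ (q %| - x + c)%Z.
  apply: contra qx => qxc'; apply: (sumx q (x + c) (x - c)) => //; last by ring.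
  by rewrite -opprB rpredN addrC.
have xc0 : x - c != 0.
  by apply: contra qxc' => /eqP xc0; rewrite (_ : - x + c = 0) ?rpred0 //; rewrite -oppr0 -xc0; ring.
have [k [n [nE n1]]] := odd_part_int xc0.
have qn : ~~ (q %| n)%Z.
  apply: contra qxc' => qn; rewrite (_ : - x + c = - (x - c)); last by ring.
  by rewrite rpredN nE dvdz_mull.
have kmn : kappa m = kappa n.
  have mn : kappa (m * n) = false.
    apply: (kD (e + k.+1)%N _ a b); first by move: m1 n1; clear; nia.
    by rewrite -E xc nE exprD exprS; ring.
  by case: kN => kM _ _; move: mn; rewrite kM //; case: (kappa m); case: (kappa n).
have Zn' : Z * Z' = (- x)%:~R ^+ 2 by rewrite Zn mulrNz sqrrN.
have := half_power ZF Zn' Zt qxc'; rewrite -/h.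
have -> : (2 * (- x + c))%:~R = -1 * ((2 ^+ k.+1)%:~R * n%:~R) :> L.
  rewrite -intrM exprS -mulrA -nE mulN1r -mulrNz; congr _%:~R; ring.
rewrite !exprMn two1 mul1r (leg n (2 ^+ (e + k) * (x + c))) //.
- have -> : (-1) ^+ h = -1 :> L.
    by rewrite -(rmorphN1 f) -rmorphXn legendre_neg1_7mod8.
  rewrite mulrNz mulN1r mulNr => /oppr_inj ->.
  by rewrite kmn mulrA -signr_addb addbb mul1r.
- by rewrite -E nE exprD; ring.
move=> l l_pr l_odd ln /dvd2 lB; apply: (sumx l (x - c) (x + c)) => //.
- by rewrite nE dvdz_mull.
- exact: lB.
by ring.
Qed.

End HalfPower.

(** * Comparing the signs at 2 *)

(** The number 2 is a square only modulo the odd primes that are 1 or -1 modulo 8,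
   and this property is multiplicative. *)
Lemma two_form_residue (A B a b : int) : (A %% 2 = 1)%Z -> b != 0 ->
  A * B = a ^+ 2 - 2 * b ^+ 2 ->
  (forall l, prime l -> odd l -> ~~ [&& l %| A, l %| B, l %| a & l %| b]%Z) ->
  (A %% 8 = 1)%Z \/ (A %% 8 = 7)%Z.
Proof.
move=> A1 b0 E cop; have A_odd : odd `|A| by move: A1; clear; lia.
pose T (n : nat) := ((n %% 8 == 1) || (n %% 8 == 7))%N.
suff : T `|A|%N by rewrite /T; clear; lia.
have TM x y : T x -> T y -> T (x * y)%N.
  by rewrite /T -(modnMm x y) => /orP[]/eqP-> /orP[]/eqP->.
apply: (odd_exponent_ind (T := T)) => //; first by case: `|A|%N A_odd.
  move=> l l_pr lA; have := dvdn_odd lA A_odd; rewrite /T -modnXm.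
  have : (l %% 8 < 8)%N by rewrite ltn_mod.
  rewrite -(odd_mod l (erefl : odd 8 = false)).
  by case: (l %% 8)%N => [|[|[|[|[|[|[|[|]]]]]]]].
move=> l l_pr ol.
have lA : (l %| `|A|)%N by move: ol; rewrite lognE; case: (l %| _)%N; rewrite // !andbF.
have l_odd := dvdn_odd lA A_odd.
have [t Nt] := odd_logn_square l_pr E b0 ol (cop l l_pr l_odd).
have t0 : t != 0 by rewrite -sqrf_eq0 -Nt two_neq0_Fp.
have := legendre_2 l_pr l_odd; rewrite [2%:R]Nt -exprM double_half_predp // Fp_fermat //.
set k := (_ || _) => e; have : k = false by apply: (sign_injF l_pr l_odd); rewrite -e.
by rewrite /k /T; move: l_odd; clear; lia.
Qed.

Lemma sqr_parity (a : int) : exists k, a ^+ 2 = a + 2 * k.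
Proof.
have [k [aE|aE]] : exists k, a = 2 * k \/ a = 2 * k + 1.
  by exists (a %/ 2)%Z; lia.
  by exists (2 * k ^+ 2 - k); rewrite aE; ring.
by exists (2 * k ^+ 2 + k); rewrite aE; ring.
Qed.

(** Put c = 4C + 1, x = 4X + 1, u = 4U + 1, d = 4D, v = 2v', y = 2y'. Dividing the
   three expressions of p - 1 by 8 shows that 3C + 2D^2, 3U + v'^2 and 3X - y'^2 are
   congruent modulo 4, while n = 2 (U + C) + 1, m1 = 2 (X + U) + 1 and
   m2 = 2 (X + C) + 1; the claim is then a matter of finitely many residues. *)
Lemma kappa_compare (p q : nat) (c d x y u v m1 m2 n : int) :
  (p %% 8 = 1)%N -> (q %% 8 = 7)%N ->
  (c %% 4 = 1)%Z -> (x %% 4 = 1)%Z -> (u %% 4 = 1)%Z ->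
  p%:Z = c ^+ 2 + d ^+ 2 -> p%:Z = x ^+ 2 + 2 * q%:Z * y ^+ 2 ->
  p%:Z = u ^+ 2 + 2 * v ^+ 2 ->
  u + c = 2 * n -> (n %% 8 = 1)%Z \/ (n %% 8 = 7)%Z ->
  x + u = 2 * m1 -> x + c = 2 * m2 -> kappa4 m1 = kappa8 m2.
Proof.
move=> p8 q8 c4 x4 u4 Ed Ey Ev un n8 xm1 xm2.
have [C cE] : exists C, c = 4 * C + 1 by exists (c %/ 4)%Z; move: c4; clear; lia.
have [X xE] : exists X, x = 4 * X + 1 by exists (x %/ 4)%Z; move: x4; clear; lia.
have [U uE] : exists U, u = 4 * U + 1 by exists (u %/ 4)%Z; move: u4; clear; lia.
have [k qE] : exists k : int, q%:Z = 8 * k + 7.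
  by exists (q %/ 8)%N%:Z; move: q8; clear; lia.
have [P pE] : exists P : int, p%:Z = 8 * P + 1.
  by exists (p %/ 8)%N%:Z; move: p8; clear; lia.
have [C2 C2E] := sqr_parity C; have [X2 X2E] := sqr_parity X.
have [U2 U2E] := sqr_parity U.
have c2 : c ^+ 2 = 8 * (3 * C + 4 * C2) + 1.
  transitivity (16 * C ^+ 2 + 8 * C + 1); first by rewrite cE; ring.
  by rewrite C2E; ring.
have x2 : x ^+ 2 = 8 * (3 * X + 4 * X2) + 1.
  transitivity (16 * X ^+ 2 + 8 * X + 1); first by rewrite xE; ring.
  by rewrite X2E; ring.
have u2 : u ^+ 2 = 8 * (3 * U + 4 * U2) + 1.
  transitivity (16 * U ^+ 2 + 8 * U + 1); first by rewrite uE; ring.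
  by rewrite U2E; ring.
rewrite c2 pE in Ed; rewrite x2 pE in Ey; rewrite u2 pE in Ev.
have [D dE] : exists D, d ^+ 2 = 16 * D.
  have [[d1 d1E]|[d1 d1E]] := sqr_mod8 d; last by move: Ed; rewrite d1E; clear; lia.
  have [[d2 d2E]|[d2 d2E]] := sqr_mod8 d1.
    by exists (d2 ^+ 2); rewrite d1E d2E; ring.
  by move: Ed; have -> : d ^+ 2 = 4 * d1 ^+ 2 by [rewrite d1E; ring]; rewrite d2E; clear; lia.
have [V vE V4] : exists2 V, v ^+ 2 = 4 * V & (V %% 4 = 0)%Z \/ (V %% 4 = 1)%Z.
  have [[v1 v1E]|[v1 v1E]] := sqr_mod8 v; last by move: Ev; rewrite v1E; clear; lia.
  exists (v1 ^+ 2); first by rewrite v1E; ring.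
  have [[v2 v2E]|[v2 v2E]] := sqr_mod8 v1; last by right; rewrite v2E; clear; lia.
  by left; rewrite v2E; have -> : (2 * v2) ^+ 2 = 4 * v2 ^+ 2 by [ring]; clear; lia.
have [Y yE Y4] : exists2 Y, q%:Z * y ^+ 2 = 4 * Y & (Y %% 4 = 0)%Z \/ (Y %% 4 = 3)%Z.
  have [[y1 y1E]|[y1 y1E]] := sqr_mod8 y; last first.
    have E : q%:Z * y ^+ 2 = 8 * (q%:Z * y1 + k) + 7 by rewrite y1E mulrDr mulr1 {2}qE; ring.
    by move: Ey; rewrite -mulrA E; clear; lia.
  exists (q%:Z * y1 ^+ 2); first by rewrite y1E; ring.
  have [[y2 y2E]|[y2 y2E]] := sqr_mod8 y1; rewrite y2E.
    by left; have -> : q%:Z * (2 * y2) ^+ 2 = 4 * (q%:Z * y2 ^+ 2) by [ring]; clear; lia.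
  right; have -> : q%:Z * (8 * y2 + 1) = 8 * (q%:Z * y2 + k) + 7.
    by rewrite mulrDr mulr1 {2}qE; ring.
  by clear; lia.
rewrite dE in Ed; rewrite vE in Ev; rewrite -mulrA yE in Ey.
have m1E : m1 = 2 * (X + U) + 1 by move: xm1; rewrite xE uE; clear; lia.
have m2E : m2 = 2 * (X + C) + 1 by move: xm2; rewrite xE cE; clear; lia.
have nE : n = 2 * (U + C) + 1 by move: un; rewrite uE cE; clear; lia.
rewrite /kappa4 /kappa8 m1E m2E; rewrite nE in n8.
move: n8 Ed Ev Ey V4 Y4; clear => n8 Ed Ev Ey V4 Y4.
by case: V4 => V4; case: Y4 => Y4; case: n8 => n8; lia.
Qed.

(** Otherwise a square other than 1 would divide p. *)
Lemma prime_form (p : nat) (M x y : int) : prime p ->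
  p%:Z = x ^+ 2 + M * y ^+ 2 ->
  y != 0 /\ forall l, prime l -> ~~ ((l %| x) && (l %| y))%Z.
Proof.
move=> p_pr pE; have nsq (l w : int) : p%:Z = l ^+ 2 * w -> `|l|%N = 1%N.
  move=> /(congr1 absz); rewrite abszM abszX /= => pw.
  have lp : (`|l| %| p)%N by rewrite pw expnS -mulnA dvdn_mulr.
  case/primeP: p_pr => p1 /(_ _ lp)/orP[/eqP //|/eqP lp'].
  move/eqP: pw; rewrite lp' expnS expn1 -mulnA -{1}[p]muln1 eqn_pmul2l ?(ltnW p1) //.
  by rewrite eq_sym muln_eq1 (gtn_eqF p1).
split.
  apply/eqP => y0; move: pE; rewrite y0 expr0n mulr0 addr0 => pE.
  have x1 := nsq x 1; rewrite mulr1 in x1.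
  have := congr1 absz pE; rewrite abszX (x1 pE) /= => p1.
  by move: (prime_gt1 p_pr); rewrite p1.
move=> l l_pr; apply/negP => /andP[/dvdzP[x' xE] /dvdzP[y' yE]].
have l1 : `|l%:Z|%N = 1%N.
  by apply: (nsq _ (x' ^+ 2 + M * y' ^+ 2)); rewrite pE xE yE; ring.
by move: (prime_gt1 l_pr); rewrite -[l]/(`|l%:Z|%N) l1.
Qed.

(** Uniqueness of the representation as a sum of two squares, by Brahmagupta's
   identity (ac + bd)^2 + (ad - bc)^2 = p^2. *)
Lemma two_squares_unique (p : nat) (a b c d : int) : prime p -> odd p ->
  p%:Z = a ^+ 2 + b ^+ 2 -> p%:Z = c ^+ 2 + d ^+ 2 ->
  (a %% 4 = 3)%Z -> (c %% 4 = 1)%Z -> a = - c /\ (b = d \/ b = - d).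
Proof.
move=> p_pr p_odd Ea Ec a3 c1.
suff main d' : p%:Z = c ^+ 2 + d' ^+ 2 -> (p %| a * c + b * d')%Z -> a = - c /\ b = - d'.
  have : (p %| (a * c + b * d) * (a * c + b * (- d)))%Z.
    apply/dvdzP; exists (a ^+ 2 + c ^+ 2 - p%:Z).
    transitivity (a ^+ 2 * c ^+ 2 - b ^+ 2 * d ^+ 2); first by ring.
    have -> : b ^+ 2 = p%:Z - a ^+ 2 by rewrite Ea; ring.
    by have -> : d ^+ 2 = p%:Z - c ^+ 2 by [rewrite Ec; ring]; ring.
  rewrite dvdzE abszM Euclid_dvdM // => /orP[h|h].
    by have [-> ->] := main d Ec h; split; [|right].
  have Ec' : p%:Z = c ^+ 2 + (- d) ^+ 2 by rewrite sqrrN.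
  by have [-> ->] := main (- d) Ec' h; rewrite opprK; split; [|left].
move=> Ed /dvdzP[k kE].
have p0 : p%:Z != 0 by rewrite -lt0n prime_gt0.
have [l lE] : exists l, a * d' - b * c = l * p%:Z.
  apply/dvdzP; have : (p %| (a * d' - b * c) ^+ 2)%Z.
    apply/dvdzP; exists (p%:Z - k ^+ 2 * p%:Z).
    transitivity (p%:Z * p%:Z - (a * c + b * d') ^+ 2); last by rewrite kE; ring.
    by rewrite {1}Ea Ed; ring.
  by rewrite expr2 !dvdzE abszM Euclid_dvdM // orbb.
have kl : k ^+ 2 + l ^+ 2 = 1.
  apply: (mulIf p0); apply: (mulIf p0).
  transitivity ((a * c + b * d') ^+ 2 + (a * d' - b * c) ^+ 2); first by rewrite kE lE; ring.
  by rewrite mul1r {1}Ea Ed; ring.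
have aE : a = k * c + l * d'.
  apply: (mulIf p0); transitivity ((a * c + b * d') * c + (a * d' - b * c) * d').
    by rewrite Ed; ring.
  by rewrite kE lE; ring.
have bE : b = k * d' - l * c.
  apply: (mulIf p0); transitivity ((a * c + b * d') * d' - (a * d' - b * c) * c).
    by rewrite Ed; ring.
  by rewrite kE lE; ring.
have d2 : (d' %% 2 = 0)%Z.
  have [[t ->]|[t tE]] := sqr_mod8 d'; first by clear; lia.
  have [[s sE]|[s sE]] := sqr_mod8 c; first by move: c1; rewrite sE; clear; lia.
  by move: p_odd Ed; rewrite tE sE; clear; lia.
have [[k1 l0]|[k0 l1]] : (k ^+ 2 = 1 /\ l = 0) \/ (k = 0 /\ l ^+ 2 = 1).
  have k0 := sqr_ge0 k; have l0 := sqr_ge0 l.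
  have [[k1 l1]|[k1 l1]] : (k ^+ 2 = 1 /\ l ^+ 2 = 0) \/ (k ^+ 2 = 0 /\ l ^+ 2 = 1).
    by move: kl k0 l0; clear; move: (k ^+ 2) (l ^+ 2) => K M; lia.
  - by left; split=> //; apply/eqP; rewrite -sqrf_eq0 l1.
  - by right; split=> //; apply/eqP; rewrite -sqrf_eq0 k1.
  have /orP[/eqP kE'|/eqP kE'] : (k == 1) || (k == -1) by rewrite -sqrf_eq1 k1.
    by move: a3 c1; rewrite aE l0 kE'; clear; lia.
  by rewrite aE bE l0 kE'; split; ring.
have /orP[/eqP lE'|/eqP lE'] : (l == 1) || (l == -1) by rewrite -sqrf_eq1 l1.
  by move: a3 d2; rewrite aE k0 lE'; clear; lia.
by move: a3 d2; rewrite aE k0 lE'; clear; lia.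
Qed.

(** * The octic character of -q *)

(** The multiplicative order of t is 4. *)
Lemma exprz_order4 (R : unitRingType) (t : R) (m n : int) :
  t ^+ 2 = -1 -> -1 != 1 :> R -> (t ^ m == t ^ n) = (4 %| m - n)%Z.
Proof.
move=> t2 R2; have tU : t \is a GRing.unit.
  by apply/unitrP; exists (- t); rewrite mulNr mulrN -expr2 t2 opprK.
have t4 : t ^ (4 : int) = 1 by rewrite -[t ^ _]/(t ^+ (2 * 2)) exprM t2 sqrrN expr1n.
have -> : (t ^ m == t ^ n) = (t ^ (m - n) == 1).
  by rewrite -[in RHS](inj_eq (mulIr (unitrXz n tU))) mul1r -exprzDr // subrK.
have [e [r [-> hr]]] : exists (e : int) (r : nat), m - n = 4 * e + r%:Z /\ r \in [:: 0; 1; 2; 3]%N.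
  exists ((m - n) %/ 4)%Z; exists `|(m - n) %% 4|%Z%N; rewrite !inE; split; lia.
rewrite exprzDr // -exprz_exp t4 exp1rz mul1r -[t ^ _]/(t ^+ r).
have t1 : t != 1 by apply: contra_neq R2 => t1; rewrite -t2 t1 expr1n.
have t3 : t ^+ 3 != 1.
  apply: contra_neq R2 => t3.
  have tN : t = -1 by apply: oppr_inj; rewrite opprK -[RHS]t3 exprS t2 mulrN1.
  by rewrite -t2 tN sqrrN expr1n.
move: hr; rewrite !inE => /or4P[]/eqP->.
- by rewrite expr0 eqxx; clear; lia.
- by rewrite expr1 (negPf t1); clear; lia.
- by rewrite t2 (negPf R2); clear; lia.
by rewrite (negPf t3); clear; lia.
Qed.

Section GaussLift.

Variables (q : nat) (L : fieldType) (i : L).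
Hypotheses (q_pr : prime q) (q8 : (q %% 8 = 7)%N) (charq : q \in [pchar L]).

(** The proof that i squares to -1 is an argument of this function so that its
   ring morphism structure can be inferred. *)
Definition gauss_eval of i ^+ 2 = -1 := fun z : gaussInt =>
  (gre z)%:~R + (gim z)%:~R * i.

Hypothesis i2 : i ^+ 2 = -1.

Lemma gauss_eval_is_zmod : zmod_morphism (gauss_eval i2).
Proof. by move=> [a b] [c d]; rewrite /gauss_eval /= !rmorphB /=; ring. Qed.

Lemma gauss_eval_is_monoid : monoid_morphism (gauss_eval i2).
Proof.
split; first by rewrite /gauss_eval /= mul0r addr0.
move=> [a b] [c d]; rewrite /gauss_eval /=.
transitivity (a%:~R * c%:~R + b%:~R * d%:~R * -1 + (a%:~R * d%:~R + b%:~R * c%:~R) * i).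
  by ring.
by rewrite -i2; ring.
Qed.

HB.instance Definition _ :=
  GRing.isZmodMorphism.Build gaussInt L (gauss_eval i2) gauss_eval_is_zmod.
HB.instance Definition _ :=
  GRing.isMonoidMorphism.Build gaussInt L (gauss_eval i2) gauss_eval_is_monoid.

(** As -1 is not a square modulo q, the kernel of this evaluation is qZ[i]. *)
Lemma gauss_eval_eq0 (z : gaussInt) : gauss_eval i2 z = 0 -> gmod q z = 0.
Proof.
case: z => a b; rewrite /gauss_eval /= => e0.
have e : a%:~R ^+ 2 + b%:~R ^+ 2 = 0 :> L.
  transitivity ((a%:~R + b%:~R * i) * (a%:~R - b%:~R * i)); last by rewrite e0 mul0r.
  by transitivity (a%:~R ^+ 2 - b%:~R ^+ 2 * i ^+ 2); [rewrite i2|]; ring.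
have {}e : (q %| a ^+ 2 + b ^+ 2)%Z.
  by rewrite (dvdz_pcharf charq) rmorphD !rmorphXn /= e.
have qb : (q %| b)%Z.
  rewrite -intF_eq0 //; apply/negP => /negP b0.
  have E : (a%:~R / b%:~R) ^+ 2 = -1 :> 'F_q.
    rewrite expr_div_n; apply: (mulIf (expf_neq0 2 b0)); rewrite divfK ?expf_neq0 //.
    apply/eqP; rewrite mulN1r -subr_eq0 opprK -!rmorphXn -rmorphD /= intF_eq0 //.
  have := legendre_neg1_7mod8 q8; rewrite -E legendre_sqr //.
    move/eqP; rewrite E eq_sym; apply/negP; apply: Fp_oppr1_neq1 => //; exact: odd_7mod8.
  by rewrite -sqrf_eq0 E oppr_eq0 oner_neq0.
have qa : (q %| a)%Z.
  have : (q %| a ^+ 2)%Z.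
    by rewrite -(addrK (b ^+ 2) (a ^+ 2)) rpredB // expr2 dvdz_mulr.
  by rewrite expr2 !dvdzE abszM Euclid_dvdM // orbb.
rewrite -(rmorph0 (gmod q)); apply/gmodP; rewrite subr0 unfold_in /= gmodulusE ?prime_gt1 //.
by rewrite qa qb.
Qed.

End GaussLift.

(** The product with the conjugate is p, which is invertible modulo q. *)
Lemma gaussMod_unit (p q : nat) (c d : int) : prime p -> prime q -> p != q ->
  p%:Z = c ^+ 2 + d ^+ 2 ->
  c%:~R + d%:~R * gmodI q \is a GRing.unit.
Proof.
move=> p_pr q_pr pq pE; have I2 : gmodI q ^+ 2 = -1 by rewrite -rmorphXn gaussI_sqr rmorphN1.
have q0 : q%:R = 0 :> gaussMod q.
  rewrite -(rmorph_nat (gmod q)) -(rmorph0 (gmod q)); apply/gmodP/gidealP; exists 1.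
  by rewrite subr0 mulr1 gmodulusE ?prime_gt1.
have [k kE] : exists k : int, p%:R * k%:~R = 1 :> gaussMod q.
  have [u] := Bezoutz p q; rewrite (_ : gcdz p q = 1); last first.
    by apply/eqP; rewrite -[_ == _]/(coprimez p q) coprimezE /= prime_coprime // dvdn_prime2.
  case=> v uv; exists u.
  have := congr1 (fun n : int => n%:~R : gaussMod q) uv.
  by rewrite /= intrD !intrM -!pmulrn q0 mulr0 addr0 mulrC.
have cd : (c%:~R + d%:~R * gmodI q) * (c%:~R - d%:~R * gmodI q) = p%:R.
  transitivity (c%:~R ^+ 2 - d%:~R ^+ 2 * gmodI q ^+ 2); first by ring.
  rewrite I2 mulrN1 opprK pmulrn pE; ring.
apply/unitrPr; exists ((c%:~R - d%:~R * gmodI q) * k%:~R); by rewrite mulrA cd kE.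
Qed.

Lemma two_squares_modp (p : nat) (c d : int) : prime p -> p%:Z = c ^+ 2 + d ^+ 2 ->
  [/\ c%:~R ^+ 2 + d%:~R ^+ 2 = 0 :> 'F_p, c%:~R != 0 :> 'F_p & d%:~R != 0 :> 'F_p].
Proof.
move=> p_pr Ed; have cd : c%:~R ^+ 2 + d%:~R ^+ 2 = 0 :> 'F_p.
  have : (p%:Z)%:~R = 0 :> 'F_p by rewrite -pmulrn (pcharf0 (pchar_Fp p_pr)).
  by rewrite Ed rmorphD !rmorphXn.
have Ed1 : p%:Z = c ^+ 2 + 1 * d ^+ 2 by rewrite mul1r.
have [_ /(_ p p_pr) copd] := prime_form p_pr Ed1; rewrite -!intF_eq0 // in copd.
split=> //.
  apply: contra copd => /[dup] c0 ->; rewrite -sqrf_eq0.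
  by move/eqP: cd; rewrite (eqP c0) expr0n add0r.
apply: contra copd => /[dup] d0 ->; rewrite andbT -sqrf_eq0.
by move/eqP: cd; rewrite (eqP d0) expr0n addr0.
Qed.

Section Core.

Variables (p q : nat) (c d x y : int).
Hypotheses (p_pr : prime p) (q_pr : prime q).
Hypotheses (p8 : (p %% 8 = 1)%N) (q8 : (q %% 8 = 7)%N).
Hypotheses (Ed : p%:Z = c ^+ 2 + d ^+ 2).
Hypotheses (Ey : p%:Z = x ^+ 2 + 2 * q%:Z * y ^+ 2).
Hypotheses (c1 : (c %% 4 = 1)%Z).

Let p_odd : odd p := octic_odd p8.
Let q_odd : odd q := odd_7mod8 q8.

Lemma p_neq_q : p != q.
Proof. by apply: contra_eq_neq p8 => ->; rewrite q8. Qed.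

Lemma p_neq0_modq (R : nzRingType) : q \in [pchar R] -> p%:R != 0 :> R.
Proof. by move=> chq; rewrite -(dvdn_pcharf chq) dvdn_prime2 // eq_sym p_neq_q. Qed.

Lemma q_ndvd_x : ~~ (q %| x)%Z.
Proof.
apply/negP => qx; have : (q %| p%:Z)%Z.
  rewrite Ey; apply: rpredD; first by rewrite expr2; exact: dvdz_mulr.
  by apply: dvdz_mulr; apply: dvdz_mull.
by rewrite dvdzE /= dvdn_prime2 // eq_sym (negPf p_neq_q).
Qed.

Section Characteristic_q.

Variables (g : 'F_p) (L : closedFieldType) (f : {rmorphism 'F_q -> L}) (z : L).
Hypotheses (g_prim : p.-1.-primitive_root g) (charq : q \in [pchar L]) (z4 : z ^+ 4 = -1).

Let e := ((q + 1) %/ 8)%N.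

Lemma q_octic : q.+1 = (8 * e)%N.
Proof. by rewrite /e; move: q8; clear; lia. Qed.

Lemma q_half_octic : (q.-1./2).+1 = (4 * e)%N.
Proof. by rewrite /e; move: q8; clear; lia. Qed.

Lemma frobenius_root8 : z ^+ q = - z ^+ 3.
Proof. by rewrite (expr_root8_mod q z4) q8; case: (root8_powers z4). Qed.

Lemma oppr1_neq1_L : -1 != 1 :> L.
Proof.
rewrite eq_sym -subr_eq0 opprK -[1 + 1]/(2%:R) -(dvdn_pcharf charq).
by rewrite dvdn_prime2 //; apply: contraTneq q_odd => ->.
Qed.

(** Since q = -1 modulo 8, the q-th power map inverts the values of chi: it sends
   the Gauss sum G of chi to that of the inverse character, up to a value of chi.
   So G^(q+1) = chi(-q) p, while G^8 is known from gauss_octic. *)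
Lemma octic_gauss_power :
  chi g z (- q%:R) * p%:R =
    (jacobi g z (-1) ^+ 4 * jacobi g (z ^+ 2) (-1) ^+ 2 * p%:R) ^+ e.
Proof.
have p0 := p_neq0_modq charq; have z8 := root8_unity8 z4.
have [w [wp wn1]] := closed_root_of_unity p_pr p0.
have z1 := unity8_predp p_pr p8 z8.
have q0 : q%:R != 0 :> 'F_p.
  by rewrite -(dvdn_pcharf (pchar_Fp p_pr)) dvdn_prime2 // p_neq_q.
have zn1 : z != 1.
  by apply: contra_neq oppr1_neq1_L => z1'; rewrite -z4 z1' expr1n.
rewrite -(gauss_octic p_pr g_prim p8 wp wn1 oppr1_neq1_L z4) -exprM -q_octic exprS.
have frob := gauss_frobenius p_pr g_prim wp charq q0 z1.
have zzq : z * z ^+ q = 1 by rewrite frobenius_root8 mulrN -exprS z4 opprK.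
have inv := gaussM_inv p_pr g_prim wp wn1 z1 zzq zn1.
rewrite -mulN1r chiM // mulrAC -inv -frob.
transitivity ((chi g z q%:R * chi g (z ^+ q) q%:R) * (gauss g w z * gauss g w z ^+ q)).
  by ring.
by rewrite -chiMl zzq chi_one q0 mul1r.
Qed.

(** Let Z = -K = U - v w and G = -J, of conjugate G'. In
   chi(-q) x^2 = Z^(4e) (G^2 x^2)^e, where x^2 = G G' represents p, the factor Z^(4e)
   is x up to the sign of m1, and G^(4e) is x up to the same sign by kappa_compare.
   Multiplying by G^e gives the quotient of G'^e and G^e. *)
Lemma octic_symbol (u v delta : int) :
  (x %% 4 = 1)%Z -> (u %% 4 = 3)%Z -> delta ^+ 2 = 1 ->
  p%:Z = u ^+ 2 + 2 * v ^+ 2 ->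
  jacobi g z (-1) = u%:~R + v%:~R * (z + z ^+ 3) ->
  jacobi g (z ^+ 2) (-1) = - (c%:~R + (delta * d)%:~R * z ^+ 2) ->
  (c%:~R - (delta * d)%:~R * z ^+ 2) ^+ e =
    chi g z (- q%:R) * (c%:~R + (delta * d)%:~R * z ^+ 2) ^+ e.
Proof.
move=> x1 u3 delta2 Ev KE JE.
set U := - u; set w := z + z ^+ 3; set G' := c%:~R - _; set G := c%:~R + _.
have U1 : (U %% 4 = 1)%Z by rewrite /U; move: u3; clear; lia.
have EU : p%:Z = U ^+ 2 + 2 * v ^+ 2 by rewrite /U sqrrN.
have [m1 m1E] : exists m1, x + U = 2 * m1.
  by exists ((x + U) %/ 2)%Z; move: x1 U1; clear; lia.
have [m2 m2E] : exists m2, x + c = 2 * m2.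
  by exists ((x + c) %/ 2)%Z; move: x1 c1; clear; lia.
have [n nE] : exists n, U + c = 2 * n.
  by exists ((U + c) %/ 2)%Z; move: U1 c1; clear; lia.
have [y0 copy] := prime_form p_pr Ey; have [v0 copv] := prime_form p_pr EU.
have dvd2 l (k : int) : prime l -> odd l -> (l %| 2 * k)%Z -> (l %| k)%Z.
  move=> l_pr l_odd; rewrite !dvdzE abszM Gauss_dvdr //=.
  by rewrite coprime_sym coprime2n.
have n8 : (n %% 8 = 1)%Z \/ (n %% 8 = 7)%Z.
  apply: (two_form_residue (B := 2 * (U - c)) (a := d) _ v0).
  - by move: nE U1 c1; clear; lia.
  - transitivity ((U + c) * (U - c)); first by rewrite nE; ring.
    transitivity ((p%:Z - c ^+ 2) - (p%:Z - U ^+ 2)); first by ring.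
    by rewrite {1}Ed EU; ring.
  move=> l l_pr l_odd; apply: contra (copv l l_pr) => /and4P[ln lB _ ->].
  rewrite andbT; apply: (dvd2 l) => //.
  have -> : 2 * U = 2 * n + (U - c) by rewrite -nE; ring.
  by apply: rpredD; [exact: dvdz_mull | exact: dvd2].
have kk : kappa4 m1 = kappa8 m2.
  exact: (kappa_compare p8 q8 c1 x1 U1 Ed Ey EU nE n8 m1E m2E).
have pL : p%:R = x%:~R ^+ 2 :> L.
  rewrite pmulrn Ey rmorphD rmorphXn !rmorphM /= -pmulrn (pcharf0 charq).
  by rewrite mulr0 mul0r addr0.
have pZ : (p%:Z)%:~R = x%:~R ^+ 2 :> L by rewrite -pmulrn.
have qx := q_ndvd_x; have x0 : x%:~R != 0 :> L by rewrite (intL_eq0 charq).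
have z3q : (z ^+ 3) ^+ q = - z.
  rewrite exprAC frobenius_root8 // exprNn -exprM (expr_root8_mod _ z4) /= expr1.
  by rewrite -signr_odd expr1 mulN1r.
have i2 : (z ^+ 2) ^+ 2 = -1 by rewrite -exprM.
have iq : (z ^+ 2) ^+ q = - z ^+ 2.
  by rewrite exprAC frobenius_root8 // sqrrN -exprM; case: (root8_powers z4).
have w2 : w ^+ 2 = - 2%:R.
  rewrite /w; transitivity (z ^+ 2 * (1 + z ^+ 4) + 2%:R * z ^+ 4); first by ring.
  by rewrite z4; ring.
set Z := U%:~R - v%:~R * w.
have Zpow : Z ^+ (4 * e) = (-1) ^+ kappa4 m1 * x%:~R.
  rewrite -q_half_octic.
  apply: (half_power_sign f q_pr q8 charq (Z' := U%:~R + v%:~R * w) (e := 1)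
           (a := 2 * v) (b := 2 * y) (legendre_char_q q_pr q8) _ m1E) => //.
  - by move=> j k a b; apply: kappa4_form.
  - by move: m1E x1 U1; clear; lia.
  - transitivity (2 * ((p%:Z - U ^+ 2) - (p%:Z - x ^+ 2))); first by rewrite expr1; ring.
    by rewrite {1}EU Ey; ring.
  - by rewrite mulf_neq0.
  - move=> l l_pr l_odd; apply: contra (copy l l_pr) => /andP[-> /=].
    exact: dvd2.
  - rewrite /Z -mulNr -mulrNz (frobenius_sum2 _ _ charq) exprMn !(frobenius_int charq).
    by rewrite (frobenius_sum2 _ _ charq) frobenius_root8 // z3q mulrNz /w; ring.
  - transitivity (U%:~R ^+ 2 - v%:~R ^+ 2 * w ^+ 2); first by rewrite /Z; ring.
    by rewrite w2 -pZ EU; ring.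
  by rewrite /Z; ring.
have Gq : G ^+ q = G'.
  by rewrite /G (frobenius_sum2 _ _ charq) exprMn !(frobenius_int charq) iq /G'; ring.
have GG' : G * G' = x%:~R ^+ 2.
  transitivity (c%:~R ^+ 2 - (delta * d)%:~R ^+ 2 * (z ^+ 2) ^+ 2); first by rewrite /G /G'; ring.
  rewrite i2 -pZ Ed -[d ^+ 2]mul1r -delta2; ring.
have Gpow : G ^+ (4 * e) = (-1) ^+ kappa8 m2 * x%:~R.
  rewrite -q_half_octic.
  apply: (half_power_sign f q_pr q8 charq (Z' := G') (e := 0)
           (a := d) (b := y) (legendre_char_2q q_pr q8) _ m2E) => //.
  - by move=> j k a b; apply: kappa8_form.
  - by move: m2E x1 c1; clear; lia.
  - transitivity ((p%:Z - c ^+ 2) - (p%:Z - x ^+ 2)); first by ring.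
    by rewrite {1}Ed Ey; ring.
  - by move=> l l_pr l_odd; apply: copy.
  by rewrite /G /G'; ring.
have := octic_gauss_power; rewrite pL KE JE -/w -/G.
have -> : u%:~R + v%:~R * w = - Z by rewrite /Z /U mulrNz; ring.
move=> main.
have {}main : chi g z (- q%:R) * x%:~R ^+ 2 = Z ^+ (4 * e) * (G ^+ 2 * (G * G')) ^+ e.
  by rewrite main -GG' exprM -exprMn; congr (_ ^+ e); ring.
apply: (mulIf (expf_neq0 2 x0)).
transitivity ((-1) ^+ kappa4 m1 * x%:~R * ((-1) ^+ kappa8 m2 * x%:~R * G' ^+ e)).
  by rewrite kk; transitivity (G' ^+ e * x%:~R ^+ 2 * ((-1) ^+ kappa8 m2 * (-1) ^+ kappa8 m2));
     [rewrite -signr_addb addbb mulr1|ring].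
rewrite -Zpow -Gpow mulrAC main -[RHS]mulrA; congr (_ * _).
by rewrite exprM -!exprMn; congr (_ ^+ e); ring.
Qed.

End Characteristic_q.

(** From x^2 = - 2 q y^2 in F_p, where 2 is a square. *)
Lemma ind_neg_q_even (g : 'F_p) : p.-1.-primitive_root g ->
  ~~ odd (ind g (- q%:R)).
Proof.
move=> g_prim; have [y0 copy] := prime_form p_pr Ey.
have q0 : q%:R != 0 :> 'F_p.
  by rewrite -(dvdn_pcharf (pchar_Fp p_pr)) dvdn_prime2 // p_neq_q.
have E : x%:~R ^+ 2 = 2%:R * (- q%:R) * y%:~R ^+ 2 :> 'F_p.
  have : (p%:Z)%:~R = 0 :> 'F_p by rewrite -pmulrn (pcharf0 (pchar_Fp p_pr)).
  rewrite Ey => e; rewrite -[LHS]subr0 -e; ring.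
have N1 := sign_predp int p_odd.
have yF : y%:~R != 0 :> 'F_p.
  apply: contra (copy p p_pr) => yF; rewrite -!intF_eq0 // yF andbT -sqrf_eq0 E.
  by rewrite (eqP yF) expr0n mulr0.
have xF : x%:~R != 0 :> 'F_p.
  by rewrite -sqrf_eq0 E !mulf_neq0 ?oppr_eq0 ?expf_neq0 // two_neq0_Fp.
have := chi_sqr p_pr g_prim p_odd int xF; rewrite E chiM // [X in _ * X]chi_sqr // mulr1 chiM //.
rewrite (chi_quadratic_2 p_pr g_prim p8) mul1r chi_ind ?oppr_eq0 // -signr_odd.
by case: (odd _).
Qed.

(** The character is defined by a generator g of F_p, whose power s of order 4 is
   d/c or its inverse. The sign delta tells which, and correspondingly whether the
   Jacobi sum of order 4 is -(c + di) or its conjugate; in the second case both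
   sides are replaced by their inverses. *)
Lemma octic_symbol_gauss : (x %% 4 = 1)%Z -> exists n : int,
  (- q%:R) ^+ ((p - 1) %/ 8) = (d%:~R / c%:~R) ^ n :> 'F_p /\
  ((c%:~R - d%:~R * gmodI q) / (c%:~R + d%:~R * gmodI q)) ^+ ((q + 1) %/ 8)
    = gmodI q ^ n :> gaussMod q.
Proof.
move=> x1; have [g g_prim] := Fp_generator p_pr.
have [u [v [a [b [[KE JE u3 a3] [Ev Ea ab]]]]]] := jacobi_coordinates p_pr g_prim p8.
have [aE bE] := two_squares_unique p_pr p_odd Ea Ed a3 c1.
have [delta delta2 bdelta] : exists2 delta : int, delta = 1 \/ delta = -1 & b = - (delta * d).
  by case: bE => ->; [exists (-1); [right|ring] | exists 1; [left|ring]].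
have dd : delta ^+ 2 = 1 by case: delta2 => ->.
have [L [f charq]] := Fp_closure q_pr; have [z z4] := closed_root8 L.
have JL : jacobi g (z ^+ 2) (-1) = - (c%:~R + (delta * d)%:~R * z ^+ 2).
  by rewrite JE // aE bdelta; ring.
have main := octic_symbol f g_prim charq z4 x1 u3 dd Ev (KE _ _ z4) JL.
set e := ((q + 1) %/ 8)%N in main *.
have ev := ind_neg_q_even g_prim; set k := ind g (- q%:R) in ev.
have q0 : - q%:R != 0 :> 'F_p.
  by rewrite oppr_eq0 -(dvdn_pcharf (pchar_Fp p_pr)) dvdn_prime2 // p_neq_q.
have kE : k = (2 * k./2)%N by rewrite mul2n even_halfK.
set n := k./2 in kE.
rewrite chi_ind // -/k kE exprM in main.
set s := (g ^+ (p.-1 %/ 8)) ^+ 2 in ab.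
have lhs : (- q%:R) ^+ ((p - 1) %/ 8) = s ^+ n :> 'F_p.
  by rewrite -(indK p_pr g_prim q0) -/k kE subn1 /s -!exprM; congr (_ ^+ _); ring.
have i2 : (z ^+ 2) ^+ 2 = -1 by rewrite -exprM.
set D := delta * d in ab main JL bdelta.
have rhs : (c%:~R - D%:~R * gmodI q) ^+ e = gmodI q ^+ n * (c%:~R + D%:~R * gmodI q) ^+ e.
  (* The difference of the two sides, lifted to Z[i], vanishes at i = z^2. *)
  pose W := (c%:~R - D%:~R * gaussI) ^+ e - gaussI ^+ n * (c%:~R + D%:~R * gaussI) ^+ e.
  have eW : gauss_eval i2 W = 0.
    have eI : gauss_eval i2 gaussI = z ^+ 2.
      by rewrite /gauss_eval /= add0r mul1r.
    have eM : gauss_eval i2 (c%:~R - D%:~R * gaussI) = c%:~R - D%:~R * z ^+ 2.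
      by rewrite rmorphB rmorphM !rmorph_int /= eI.
    have eP : gauss_eval i2 (c%:~R + D%:~R * gaussI) = c%:~R + D%:~R * z ^+ 2.
      by rewrite rmorphD rmorphM !rmorph_int /= eI.
    rewrite /W rmorphB [X in _ - X]rmorphM !rmorphXn /=.
    by rewrite [X in X ^+ e - _]eM [X in _ * X ^+ e]eP [X in X ^+ n]eI main subrr.
  have := gauss_eval_eq0 q_pr q8 charq eW.
  rewrite /W rmorphB [X in _ - X]rmorphM !rmorphXn /= rmorphB rmorphD rmorphM !rmorph_int.
  by move/eqP; rewrite subr_eq0 => /eqP.
have unitG (h : int) : p%:Z = c ^+ 2 + h ^+ 2 -> c%:~R + h%:~R * gmodI q \is a GRing.unit.
  exact: gaussMod_unit p_pr q_pr p_neq_q.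
have uP := unitG d Ed; have uN := unitG (- d); rewrite sqrrN mulrNz mulNr in uN.
have {}uN := uN Ed.
have [cd c0 d0] := two_squares_modp p_pr Ed.
case: delta2 => deltaE; move: ab rhs; rewrite bdelta aE /D deltaE ?mul1r ?mulN1r ?opprK.
  move=> ab rhs; exists n; split; last by rewrite expr_div_n rhs mulrK // unitrX.
  rewrite lhs; congr (_ ^+ _); apply: (mulIf c0); rewrite divfK //; apply: (mulfI d0).
  apply/eqP; rewrite -subr_eq0; apply/eqP.
  transitivity (- ((- c)%:~R + (- d)%:~R * s) * c%:~R - (c%:~R ^+ 2 + d%:~R ^+ 2)); first by ring.
  by rewrite ab cd oppr0 mul0r addr0.
move=> ab rhs; exists (- n%:Z); split.
  rewrite lhs -exprnN -exprVn invf_div; congr (_ ^+ _).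
  apply: (mulIf d0); rewrite divfK //; apply/eqP; rewrite -subr_eq0 -ab; apply/eqP; ring.
move: rhs; rewrite mulrNz mulNr opprK => rhs.
rewrite expr_div_n rhs invrM ?unitrX ?gmodI_unit //.
by rewrite mulrA divrr ?unitrX // mul1r -exprnN.
Qed.

End Core.

Theorem theorem4p4 (p q : nat) (c d x y d0 : int) (r : nat) (m : int)
    (hp : prime p) (hq : prime q)
    (hp8 : (p = 1 %[mod 8])%N) (hq8 : (q = 7 %[mod 8])%N)
    (hcd : p%:Z = c ^+ 2 + d ^+ 2)
    (hxy : p%:Z = x ^+ 2 + 2 * q%:Z * y ^+ 2)
    (hc : (c = 1 %[mod 4])%Z)
    (hd : d = 2 ^+ r * d0) (hd0 : (d0 = 1 %[mod 4])%Z)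
    (hgcd : gcdz c (x + d) = 1 \/ gcdz d0 (x + c) = 1) :
  (- q%:R) ^+ ((p - 1) %/ 8) = (d%:~R / c%:~R) ^ m :> 'F_p
  <->
  ((c%:~R - d%:~R * gmodI q) / (c%:~R + d%:~R * gmodI q)) ^+ ((q + 1) %/ 8)
    = gmodI q ^ m :> gaussMod q.
Proof.
have c1 : (c %% 4 = 1)%Z by rewrite hc.
have x2 : (x %% 4 = 1)%Z \/ ((- x) %% 4 = 1)%Z.
  have [[k kE]|[k kE]] := sqr_mod8 x; last first.
    have [[h hE]|[h hE]] : (exists h, x = 2 * h) \/ (exists h, x = 2 * h + 1).
    - have [h [hE|hE]] : exists h, x = 2 * h \/ x = 2 * h + 1 by exists (x %/ 2)%Z; lia.
        by left; exists h.
      by right; exists h.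
    - by have : 2 * (2 * h ^+ 2) = 8 * k + 1 by [rewrite -kE hE; ring]; clear; lia.
    by rewrite hE; clear; lia.
  have p_odd := octic_odd hp8; move: p_odd hxy; rewrite kE.
  have -> : (2 * k) ^+ 2 + 2 * q%:Z * y ^+ 2 = 2 * (2 * k ^+ 2 + q%:Z * y ^+ 2) by ring.
  by clear; lia.
(* One of x and -x is 1 modulo 4, and both represent p in the same way. *)
have [n [-> ->]] : exists n : int,
  (- q%:R) ^+ ((p - 1) %/ 8) = (d%:~R / c%:~R) ^ n :> 'F_p /\
  ((c%:~R - d%:~R * gmodI q) / (c%:~R + d%:~R * gmodI q)) ^+ ((q + 1) %/ 8)
    = gmodI q ^ n :> gaussMod q.
  case: x2 => [x1|x1]; first exact: (octic_symbol_gauss hp hq hp8 hq8 hcd hxy c1 x1).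
  have hxy' : p%:Z = (- x) ^+ 2 + 2 * q%:Z * y ^+ 2 by rewrite sqrrN.
  exact: (octic_symbol_gauss hp hq hp8 hq8 hcd hxy' c1 x1).
have p_odd := octic_odd hp8; have q_odd := odd_7mod8 hq8.
have t2 : (d%:~R / c%:~R) ^+ 2 = -1 :> 'F_p.
  have [cd c0 _] := two_squares_modp hp hcd.
  rewrite expr_div_n; apply: (mulIf (expf_neq0 2 c0)); rewrite divfK ?expf_neq0 //.
  by apply/eqP; rewrite mulN1r -subr_eq0 opprK addrC cd.
have I2 : gmodI q ^+ 2 = -1 by rewrite -rmorphXn gaussI_sqr rmorphN1.
have R2 : -1 != 1 :> gaussMod q.
  apply/eqP; rewrite -(rmorph1 (gmod q)) -rmorphN => /gmodP.
  rewrite unfold_in /= gmodulusE ?prime_gt1 // => /andP[q2 _].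
  by have := dvdn_leq (isT : 0 < 2)%N q2; move: hq8; clear; case: q => [|[|[|]]].
by split=> /eqP; rewrite exprz_order4 ?Fp_oppr1_neq1 // => nm; apply/eqP; rewrite exprz_order4 ?Fp_oppr1_neq1.
Qed.
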